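(* There is a nonempty $\Pi^0_1$ class $\mathcal P\subseteq 2^\omega$ with no computable members such that every member of $\mathcal P$ is BLR traceable.
   Context: An order function is a computable nondecreasing unbounded function. A function is $\omega$-c.e. by $A$ if it equals $\lim_t\Gamma^A(x,t)$ for an $A$-computable $\Gamma^A$ whose number of changes at $x$ is bounded by a computable function of $x$. A BLR trace is a sequence $(T_n)$ with $T_n=W_{r(n)}$ where $r(n)=\lim_t g(n,t)$ for a computable $g$ whose number of changes is computably bounded; it has bound $h$ if $|T_n|\le h(n)$. $A$ is BLR traceable if for some order function $h$, every function $f$ that is $\omega$-c.e. by $A$ has a BLR trace $(T_n)$ with bound $h$ and $f(n)\in T_n$ for all $n$. *)

(* Defs.v *)
From Stdlib Require Import Arith List Cantor.
Import ListNotations.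

Definition pair (x y : nat) : nat := Cantor.to_nat (x, y).
Definition fst' (n : nat) : nat := fst (Cantor.of_nat n).
Definition snd' (n : nat) : nat := snd (Cantor.of_nat n).

Inductive code : Type :=
| CZero
| CSucc
| CFst
| CSnd
| COracle
| CPair (f g : code)
| CComp (f g : code)
| CRec (f g : code)    (* h<a,0> = f a ; h<a,n+1> = g <a,<n,h<a,n>>> *)
| CMin (f : code).     (* x |-> least n with f<x,n> = 0 (all earlier defined) *)

Definition obind (o : option nat) (k : nat -> option nat) : option nat :=
  match o with Some v => k v | None => None end.

Fixpoint eval (s : nat) (A : nat -> bool) (c : code) (x : nat) : option nat :=
  match s with
  | 0 => None
  | S s' =>
    match c with
    | CZero => Some 0
    | CSucc => Some (S x)
    | CFst => Some (fst' x)
    | CSnd => Some (snd' x)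
    | COracle => Some (if A x then 1 else 0)
    | CPair f g =>
        obind (eval s' A f x) (fun u => obind (eval s' A g x) (fun v => Some (pair u v)))
    | CComp f g => obind (eval s' A g x) (fun u => eval s' A f u)
    | CRec f g =>
        let a := fst' x in
        (fix loop (n : nat) : option nat :=
           match n with
           | 0 => eval s' A f a
           | S m => obind (loop m) (fun h => eval s' A g (pair a (pair m h)))
           end) (snd' x)
    | CMin f =>
        (fix search (k i : nat) : option nat :=
           match k with
           | 0 => None
           | S k' => obind (eval s' A f (pair x i))
                       (fun v => if Nat.eqb v 0 then Some i else search k' (S i))
           end) s' 0
    end
  end.

Fixpoint decode_fuel (fuel n : nat) : code :=
  match fuel with
  | 0 => CZero
  | S fuel' =>
    match n with
    | 0 => CZero
    | S m =>
      let tag := fst' m in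
      let r := snd' m in
      match tag with
      | 0 => CSucc
      | 1 => CFst
      | 2 => CSnd
      | 3 => COracle
      | 4 => CPair (decode_fuel fuel' (fst' r)) (decode_fuel fuel' (snd' r))
      | 5 => CComp (decode_fuel fuel' (fst' r)) (decode_fuel fuel' (snd' r))
      | 6 => CRec (decode_fuel fuel' (fst' r)) (decode_fuel fuel' (snd' r))
      | 7 => CMin (decode_fuel fuel' r)
      | _ => CZero
      end
    end
  end.

Definition decode (e : nat) : code := decode_fuel (S e) e.

Definition Phi (e : nat) (A : nat -> bool) (x y : nat) : Prop :=
  exists s, eval s A (decode e) x = Some y.

Definition no_oracle : nat -> bool := fun _ => false.

Definition phi (e x y : nat) : Prop := Phi e no_oracle x y.

Definition W (e : nat) (x : nat) : Prop := exists y, phi e x y.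

Definition computable (f : nat -> nat) : Prop :=
  exists e, forall x, phi e x (f x).

Definition computable2 (g : nat -> nat -> nat) : Prop :=
  computable (fun p => g (fst' p) (snd' p)).

Definition A_computable2 (A : nat -> bool) (g : nat -> nat -> nat) : Prop :=
  exists e, forall p, Phi e A p (g (fst' p) (snd' p)).

Definition computable_set (A : nat -> bool) : Prop :=
  computable (fun x => if A x then 1 else 0).

Fixpoint changes_upto (g : nat -> nat -> nat) (x T : nat) : nat :=
  match T with
  | 0 => 0
  | S T' => changes_upto g x T' + (if Nat.eqb (g x T') (g x (S T')) then 0 else 1)
  end.

Definition bounded_limit (g : nat -> nat -> nat) (b : nat -> nat) (f : nat -> nat) : Prop :=
  (forall x, exists t0, forall t, t0 <= t -> g x t = f x) /\
  (forall x T, changes_upto g x T <= b x).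

Definition order_function (h : nat -> nat) : Prop :=
  computable h /\
  (forall m n, m <= n -> h m <= h n) /\
  (forall k, exists n, k <= h n).

Definition omega_ce_by (A : nat -> bool) (f : nat -> nat) : Prop :=
  exists (Gamma : nat -> nat -> nat) (b : nat -> nat),
    A_computable2 A Gamma /\ computable b /\ bounded_limit Gamma b f.

(* r(n) = lim_t g(n,t) with g computable and computably bounded changes;
   the BLR trace is then T_n = W_{r n} *)
Definition BLR_index (r : nat -> nat) : Prop :=
  exists (g : nat -> nat -> nat) (b : nat -> nat),
    computable2 g /\ computable b /\ bounded_limit g b r.

Definition card_le (S : nat -> Prop) (k : nat) : Prop :=
  forall l : list nat, NoDup l -> (forall x, In x l -> S x) -> length l <= k.

Definition BLR_traceable (A : nat -> bool) : Prop :=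
  exists h, order_function h /\
    forall f, omega_ce_by A f ->
      exists r, BLR_index r /\
        (forall n, card_le (W (r n)) (h n)) /\
        (forall n, W (r n) (f n)).

Definition Pi01_class (P : (nat -> bool) -> Prop) : Prop :=
  exists e, forall A, P A <-> ~ (exists y, Phi e A 0 y).

(* Main.v *)
Require Import Defs.
From Stdlib Require Import Arith List Cantor Lia Bool Sorted Classical IndefiniteDescription.
Import ListNotations.

(* The class is the set of paths through a decreasing sequence of finite sets of leaves, the set of
   stage s consisting of strings of length s.  A requirement (n, e) with e <= n asks to trace at n
   the limit of the functional coded by e; it becomes a claim of level n once its bound on the
   number of changes converges, and claims are ordered by arrival.  A claim of level l looks at the
   2^l blocks of leaves given by the first l branchings: when the histories of values of its
   functional differ within a block, the block is cut down to one leaf with a longest history.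

   A claim that arrives with a level n below those of older claims lowers them to n, while the older
   claims keep their priority.  Hence levels increase along the list, a claim is disturbed only by
   older ones, and the bounds of all of these are known at its arrival: the potentials (level plus
   number of changes still possible in each block) decrease lexicographically, so the at most 2^n
   final values of a claim are approximated with a computably bounded number of changes.

   Only finitely many claims have level at most n, so in the limit every block keeps branching.  If
   a member A were computable, trace the functional that switches from 0 to 1 when its oracle is seen
   to differ from A: another path in the same block would have to produce the same value as A. *)

(** The obstacle is that the single order [2 ^ n] must serve every functional while the changes of a
    trace stay computably bounded. Ordering claims by level would let a late claim of low level,
    whose bound was unknown before, injure older claims; ordering by arrival alone would let its
    pruning destroy the finer blocks of older claims. Lowering the older claims resolves this.
    Coarser blocks mean fewer values, so the cardinality bound survives; and a merged block has no
    more potential than its two halves together, because a maximum is at most a sum. A longest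
    history is kept because each recorded value uses up one of the at most b + 1 allowed: cutting a
    block that was uniform one stage earlier leaves less room for further values. The condition e <=
    n leaves finitely many requirements per level; the values at the arguments below e are written
    into the trace by hand, which is harmless since a trace may depend on its function
    non-uniformly. *)

(** * Pairing, fuelled evaluation and its rules *)

Lemma fst'_pair a b : fst' (pair a b) = a.
Proof. unfold fst', pair. now rewrite cancel_of_to. Qed.

Lemma snd'_pair a b : snd' (pair a b) = b.
Proof. unfold snd', pair. now rewrite cancel_of_to. Qed.

Lemma pair_fst_snd p : pair (fst' p) (snd' p) = p.
Proof. unfold fst', snd', pair. rewrite <- surjective_pairing. apply cancel_to_of. Qed.

Lemma pair_inj a b c d : pair a b = pair c d -> a = c /\ b = d.
Proof. unfold pair. intros H. apply to_nat_inj in H. now inversion H. Qed.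

Lemma pair_ge a b : a + b <= pair a b.
Proof. pose proof (to_nat_non_decreasing a b). unfold pair. lia. Qed.

Global Opaque pair fst' snd'.

(** Convertible to the anonymous loop inside [eval], as is [eval_min] below; the names allow an
    induction on the loop counter to be stated. *)
Definition eval_rec (ev : code -> nat -> option nat) (f g : code) (a : nat) :=
  fix loop (n : nat) : option nat :=
    match n with
    | 0 => ev f a
    | S m => obind (loop m) (fun h => ev g (pair a (pair m h)))
    end.

Definition eval_min (ev : code -> nat -> option nat) (f : code) (x : nat) :=
  fix search (k i : nat) : option nat :=
    match k with
    | 0 => None
    | S k' => obind (ev f (pair x i))
                (fun v => if Nat.eqb v 0 then Some i else search k' (S i))
    end.

Lemma eval_mono s : forall A c x y t,
  eval s A c x = Some y -> s <= t -> eval t A c x = Some y.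
Proof.
  induction s as [|s IH]; intros A c x y t H L; [discriminate|].
  destruct t as [|t]; [lia|]. assert (Lt : s <= t) by lia.
  destruct c; cbn [eval] in *; auto.
  - destruct (eval s A c1 x) as [u|] eqn:E1; [|discriminate].
    destruct (eval s A c2 x) as [v|] eqn:E2; [|discriminate].
    now rewrite (IH _ _ _ _ _ E1 Lt), (IH _ _ _ _ _ E2 Lt).
  - destruct (eval s A c2 x) as [v|] eqn:E2; [|discriminate].
    rewrite (IH _ _ _ _ _ E2 Lt). cbn in *. eauto.
  - revert H. generalize (snd' x) as n. intros n. revert y.
    induction n as [|n IHn]; intros y H; [eauto|].
    match type of H with obind ?o _ = _ => destruct o as [h|] eqn:E; [|discriminate] end.
    rewrite (IHn _ eq_refl). cbn in *. eauto.
  - change (eval_min (eval s A) c x s 0 = Some y) in H.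
    change (eval_min (eval t A) c x t 0 = Some y).
    revert H Lt. generalize 0. revert t L.
    (* The fuel of [CMin] is both the fuel of the body and the number of candidates, so the
       induction lets the two grow separately. *)
    enough (G : forall k k' i t, eval_min (eval s A) c x k i = Some y -> s <= t -> k <= k' ->
              eval_min (eval t A) c x k' i = Some y) by (intros; eapply G; eauto).
    induction k as [|k IHk]; intros k' i t H L1 L2; [discriminate|].
    destruct k' as [|k']; [lia|]. cbn [eval_min] in *.
    destruct (eval s A c (pair x i)) as [v|] eqn:E; [|discriminate].
    rewrite (IH _ _ _ _ _ E L1). cbn in *. destruct (v =? 0); auto.
    apply IHk; auto. lia.
Qed.

Definition run (A : nat -> bool) (c : code) (x y : nat) : Prop :=
  exists s, eval s A c x = Some y.

Lemma run_det A c x y z : run A c x y -> run A c x z -> y = z.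
Proof.
  intros [s H] [t K].
  apply eval_mono with (t := s + t) in H; [|lia].
  apply eval_mono with (t := s + t) in K; [|lia]. congruence.
Qed.

Lemma run_zero A x : run A CZero x 0. Proof. now exists 1. Qed.
Lemma run_succ A x : run A CSucc x (S x). Proof. now exists 1. Qed.
Lemma run_fst A x : run A CFst x (fst' x). Proof. now exists 1. Qed.
Lemma run_snd A x : run A CSnd x (snd' x). Proof. now exists 1. Qed.
Lemma run_oracle A x : run A COracle x (if A x then 1 else 0). Proof. now exists 1. Qed.

Lemma run_fst_pair A a b : run A CFst (pair a b) a.
Proof. exists 1. cbn. now rewrite fst'_pair. Qed.

Lemma run_snd_pair A a b : run A CSnd (pair a b) b.
Proof. exists 1. cbn. now rewrite snd'_pair. Qed.

Lemma run_id A x : run A (CPair CFst CSnd) x x.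
Proof. exists 2. cbn. now rewrite pair_fst_snd. Qed.

Lemma run_pair A f g x u v : run A f x u -> run A g x v -> run A (CPair f g) x (pair u v).
Proof.
  intros [s H] [t K]. exists (S (s + t)). cbn [eval].
  rewrite (eval_mono _ _ _ _ _ (s + t) H), (eval_mono _ _ _ _ _ (s + t) K) by lia. reflexivity.
Qed.

Lemma run_comp A f g x u v : run A g x u -> run A f u v -> run A (CComp f g) x v.
Proof.
  intros [s H] [t K]. exists (S (s + t)). cbn [eval].
  rewrite (eval_mono _ _ _ _ _ (s + t) H) by lia. cbn.
  rewrite (eval_mono _ _ _ _ _ (s + t) K) by lia. reflexivity.
Qed.

Lemma run_rec0 A f g x y : snd' x = 0 -> run A f (fst' x) y -> run A (CRec f g) x y.
Proof. intros E [s H]. exists (S s). cbn [eval]. now rewrite E. Qed.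

Lemma run_recS A f g x n h y : snd' x = S n ->
  run A (CRec f g) (pair (fst' x) n) h -> run A g (pair (fst' x) (pair n h)) y ->
  run A (CRec f g) x y.
Proof.
  intros E [s H] [t K]. exists (S (s + t)).
  apply eval_mono with (t := S (s + t)) in H; [|lia].
  apply eval_mono with (t := s + t) in K; [|lia].
  cbn [eval] in *. rewrite E. rewrite fst'_pair, snd'_pair in H. rewrite H. exact K.
Qed.

(** A search uses the same fuel for all its bodies and takes it as its number of candidates; hence
    one [s] for all [j], and the extra [n <= s]. *)
Lemma run_uniform_fuel A c (x : nat -> nat) (v : nat -> nat) n :
  (forall j, j < n -> run A c (x j) (v j)) ->
  exists s, n <= s /\ forall j, j < n -> eval s A c (x j) = Some (v j).
Proof.
  induction n as [|n IH]; intros H.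
  - exists 0. split; [lia|intros; lia].
  - destruct IH as [s [L Hs]]; [intros; apply H; lia|].
    destruct (H n (Nat.lt_succ_diag_r n)) as [t Ht].
    exists (S (s + t)). split; [lia|]. intros j Lj.
    destruct (Nat.eq_dec j n) as [->|].
    + apply eval_mono with (s := t); [easy|lia].
    + apply eval_mono with (s := s); [apply Hs; lia|lia].
Qed.

Lemma run_min A f x i (v : nat -> nat) :
  (forall j, j <= i -> run A f (pair x j) (v j)) ->
  (forall j, j < i -> v j <> 0) -> v i = 0 -> run A (CMin f) x i.
Proof.
  intros H Hlt Hi.
  destruct (run_uniform_fuel A f (pair x) v (S i)) as [s [L Hs]]; [intros; apply H; lia|].
  exists (S s). change (eval_min (eval s A) f x s 0 = Some i).
  assert (G : forall d k j, i = j + d -> d < k -> eval_min (eval s A) f x k j = Some i).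
  { induction d as [|d IHd]; intros [|k] j E Lk; try lia; cbn [eval_min];
      rewrite (Hs j) by lia; cbn.
    - replace j with i by lia. now rewrite Hi.
    - destruct (v j =? 0) eqn:Ev.
      + apply Nat.eqb_eq in Ev. exfalso. apply (Hlt j); [lia|easy].
      + apply IHd; lia. }
  apply (G i); lia.
Qed.

Lemma eval_min_inv ev f x y : forall k i, eval_min ev f x k i = Some y ->
  ev f (pair x y) = Some 0 /\ forall j, i <= j < y -> exists v, ev f (pair x j) = Some (S v).
Proof.
  induction k as [|k IHk]; intros j E; [discriminate|].
  cbn [eval_min] in E. destruct (ev f (pair x j)) as [v|] eqn:Ev; [|discriminate].
  cbn in E. destruct (v =? 0) eqn:Ez.
  - apply Nat.eqb_eq in Ez. inversion E; subst. split; [easy|intros; lia].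
  - destruct (IHk _ E) as [H1 H2]. split; [easy|]. intros j' Lj.
    destruct (Nat.eq_dec j j') as [<-|]; [|apply H2; lia].
    destruct v as [|v]; [discriminate|]. now exists v.
Qed.

Lemma run_min_inv A f x i : run A (CMin f) x i -> run A f (pair x i) 0.
Proof.
  intros [[|s] H]; [discriminate|].
  change (eval_min (eval s A) f x s 0 = Some i) in H.
  apply eval_min_inv in H as [H _]. now exists s.
Qed.

Lemma run_comp_inv A f g x v : run A (CComp f g) x v -> exists u, run A g x u /\ run A f u v.
Proof.
  intros [[|s] H]; [discriminate|]. cbn [eval] in H.
  destruct (eval s A g x) as [u|] eqn:E; [|discriminate].
  exists u. split; now exists s.
Qed.

(** * Numerical coding of programs *)

Fixpoint encode (c : code) : nat :=
  match c with
  | CZero => 0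
  | CSucc => S (pair 0 0)
  | CFst => S (pair 1 0)
  | CSnd => S (pair 2 0)
  | COracle => S (pair 3 0)
  | CPair f g => S (pair 4 (pair (encode f) (encode g)))
  | CComp f g => S (pair 5 (pair (encode f) (encode g)))
  | CRec f g => S (pair 6 (pair (encode f) (encode g)))
  | CMin f => S (pair 7 (encode f))
  end.

Lemma decode_fuel_encode c : forall n, encode c < n -> decode_fuel n (encode c) = c.
Proof.
  induction c; intros [|n] L; try lia; cbn [encode decode_fuel] in *;
    rewrite ?fst'_pair, ?snd'_pair, ?fst'_pair; try reflexivity.
  - pose proof (pair_ge (encode c1) (encode c2)).
    pose proof (pair_ge 4 (pair (encode c1) (encode c2))).
    rewrite IHc1, IHc2 by lia. reflexivity.
  - pose proof (pair_ge (encode c1) (encode c2)).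
    pose proof (pair_ge 5 (pair (encode c1) (encode c2))).
    rewrite IHc1, IHc2 by lia. reflexivity.
  - pose proof (pair_ge (encode c1) (encode c2)).
    pose proof (pair_ge 6 (pair (encode c1) (encode c2))).
    rewrite IHc1, IHc2 by lia. reflexivity.
  - pose proof (pair_ge 7 (encode c)). rewrite IHc by lia. reflexivity.
Qed.

Lemma decode_encode c : decode (encode c) = c.
Proof. apply decode_fuel_encode. lia. Qed.

Lemma decode_fuel_irrel n : forall s t, n < s -> n < t -> decode_fuel s n = decode_fuel t n.
Proof.
  induction n as [n IH] using lt_wf_ind. intros [|s] [|t] Ls Lt; try lia.
  destruct n as [|m]; [reflexivity|]. cbn [decode_fuel].
  pose proof (pair_ge (fst' m) (snd' m)) as H. rewrite pair_fst_snd in H.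
  pose proof (pair_ge (fst' (snd' m)) (snd' (snd' m))) as H'. rewrite pair_fst_snd in H'.
  rewrite (IH (fst' (snd' m)) ltac:(lia) s t) by lia.
  rewrite (IH (snd' (snd' m)) ltac:(lia) s t) by lia.
  rewrite (IH (snd' m) ltac:(lia) s t) by lia. reflexivity.
Qed.

Lemma decode_S m : decode (S m) =
  let r := snd' m in
  let f := decode (fst' r) in let g := decode (snd' r) in
  match fst' m with
  | 0 => CSucc
  | 1 => CFst
  | 2 => CSnd
  | 3 => COracle
  | 4 => CPair f g
  | 5 => CComp f g
  | 6 => CRec f g
  | 7 => CMin (decode r)
  | _ => CZero
  end.
Proof.
  pose proof (pair_ge (fst' m) (snd' m)) as H. rewrite pair_fst_snd in H.
  pose proof (pair_ge (fst' (snd' m)) (snd' (snd' m))) as H'. rewrite pair_fst_snd in H'.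
  (* The remaining fuel is made opaque so that only one layer of [decode_fuel] unfolds; fuels are
     then exchanged by [decode_fuel_irrel]. *)
  unfold decode. generalize (eq_refl (S m)). generalize (S m) at 1 3 as k. intros k Ek.
  cbn [decode_fuel]. cbv zeta. subst k.
  rewrite (decode_fuel_irrel (fst' (snd' m)) (S m) (S (fst' (snd' m)))) by lia.
  rewrite (decode_fuel_irrel (snd' (snd' m)) (S m) (S (snd' (snd' m)))) by lia.
  rewrite (decode_fuel_irrel (snd' m) (S m) (S (snd' m))) by lia. reflexivity.
Qed.

(** * Computability of functions between encodable types *)

Class Enc (X : Type) := { enc : X -> nat; enc_inj : forall x y, enc x = enc y -> x = y }.

Instance Enc_nat : Enc nat := {| enc := fun n => n; enc_inj := fun _ _ e => e |}.

Instance Enc_bool : Enc bool.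
Proof. exists (fun b : bool => if b then 1 else 0). now intros [] []. Defined.

Instance Enc_prod {X Y} {EX : Enc X} {EY : Enc Y} : Enc (X * Y).
Proof.
  exists (fun p => pair (enc (fst p)) (enc (snd p))).
  intros [a b] [c d] H. apply pair_inj in H as [H1 H2]. cbn in *.
  apply enc_inj in H1, H2. congruence.
Defined.

Instance Enc_option {X} {EX : Enc X} : Enc (option X).
Proof.
  exists (fun o => match o with None => 0 | Some x => S (enc x) end).
  intros [a|] [b|]; try easy. intros H. injection H as H. apply enc_inj in H. congruence.
Defined.

Fixpoint enc_list {X} {EX : Enc X} (l : list X) : nat :=
  match l with [] => 0 | a :: t => S (pair (enc a) (enc_list t)) end.

Instance Enc_list {X} {EX : Enc X} : Enc (list X).
Proof.
  exists enc_list.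
  induction x as [|a x IH]; intros [|b y]; try easy. cbn. intros H. injection H as H.
  apply pair_inj in H as [H1 H2]. apply enc_inj in H1. apply IH in H2. congruence.
Defined.

(** The oracle is an argument of [F], so one notion covers functionals and, when [F] ignores it,
    computable functions; a single code must work for all oracles. *)
Definition Comp {X Y} {EX : Enc X} {EY : Enc Y} (F : (nat -> bool) -> X -> Y) : Prop :=
  exists c, forall A x, run A c (enc x) (enc (F A x)).

Lemma comp_ext {X Y} {EX : Enc X} {EY : Enc Y} (F G : (nat -> bool) -> X -> Y) :
  (forall A x, F A x = G A x) -> Comp G -> Comp F.
Proof. intros H [c K]. exists c. intros. now rewrite H. Qed.

Lemma comp_var {X} {EX : Enc X} : Comp (fun _ (x : X) => x).
Proof.
  exists (CPair CFst CSnd). intros. apply run_id.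
Qed.

Lemma comp_subst {X Y Z} {EX : Enc X} {EY : Enc Y} {EZ : Enc Z}
  (G : (nat -> bool) -> Y -> Z) (F : (nat -> bool) -> X -> Y) :
  Comp G -> Comp F -> Comp (fun A x => G A (F A x)).
Proof.
  intros [c Hc] [d Hd]. exists (CComp c d). intros. eapply run_comp; [apply Hd|apply Hc].
Qed.

Fixpoint const_code (n : nat) : code :=
  match n with 0 => CZero | S m => CComp CSucc (const_code m) end.

Lemma run_const_code A n x : run A (const_code n) x n.
Proof.
  induction n as [|n IH]; [apply run_zero|]. cbn. eapply run_comp; [apply IH|apply run_succ].
Qed.

Lemma comp_const {X Y} {EX : Enc X} {EY : Enc Y} (y : Y) : Comp (fun _ (_ : X) => y).
Proof. exists (const_code (enc y)). intros. apply run_const_code. Qed.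

Lemma comp_pair {X Y Z} {EX : Enc X} {EY : Enc Y} {EZ : Enc Z}
  (F : (nat -> bool) -> X -> Y) (G : (nat -> bool) -> X -> Z) :
  Comp F -> Comp G -> Comp (fun A x => (F A x, G A x)).
Proof. intros [c Hc] [d Hd]. exists (CPair c d). intros. now apply run_pair. Qed.

Lemma comp_fst {X Y Z} {EX : Enc X} {EY : Enc Y} {EZ : Enc Z} (F : (nat -> bool) -> X -> Y * Z) :
  Comp F -> Comp (fun A x => fst (F A x)).
Proof.
  intros H. apply (comp_subst (fun _ p => fst p)); [|easy].
  exists CFst. intros A [a b]. apply run_fst_pair.
Qed.

Lemma comp_snd {X Y Z} {EX : Enc X} {EY : Enc Y} {EZ : Enc Z} (F : (nat -> bool) -> X -> Y * Z) :
  Comp F -> Comp (fun A x => snd (F A x)).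
Proof.
  intros H. apply (comp_subst (fun _ p => snd p)); [|easy].
  exists CSnd. intros A [a b]. apply run_snd_pair.
Qed.

Lemma comp_S {X} {EX : Enc X} (F : (nat -> bool) -> X -> nat) :
  Comp F -> Comp (fun A x => S (F A x)).
Proof.
  intros H. apply (comp_subst (fun _ p => S p)); [|easy]. exists CSucc. intros. apply run_succ.
Qed.

Lemma comp_fst' {X} {EX : Enc X} (F : (nat -> bool) -> X -> nat) :
  Comp F -> Comp (fun A x => fst' (F A x)).
Proof.
  intros H. apply (comp_subst (fun _ p => fst' p)); [|easy]. exists CFst. intros. apply run_fst.
Qed.

Lemma comp_snd' {X} {EX : Enc X} (F : (nat -> bool) -> X -> nat) :
  Comp F -> Comp (fun A x => snd' (F A x)).
Proof.
  intros H. apply (comp_subst (fun _ p => snd' p)); [|easy]. exists CSnd. intros. apply run_snd.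
Qed.

Lemma comp_pair' {X} {EX : Enc X} (F G : (nat -> bool) -> X -> nat) :
  Comp F -> Comp G -> Comp (fun A x => pair (F A x) (G A x)).
Proof. intros [c Hc] [d Hd]. exists (CPair c d). intros. now apply run_pair. Qed.

Lemma comp_oracle {X} {EX : Enc X} (F : (nat -> bool) -> X -> nat) :
  Comp F -> Comp (fun A x => A (F A x)).
Proof.
  intros H. apply (comp_subst (fun A p => A p)); [|easy]. exists COracle. intros. apply run_oracle.
Qed.

(** Recursion and case distinction go through named combinators ([natrec], [ncase], [ocase],
    [lcase], [listrec]) so that the tactic [comp] can recognise them by matching. *)
Fixpoint natrec {Y} (y : Y) (g : nat -> Y -> Y) (n : nat) : Y :=
  match n with 0 => y | S m => g m (natrec y g m) end.

Lemma comp_natrec {X Y} {EX : Enc X} {EY : Enc Y}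
  (n : (nat -> bool) -> X -> nat) (F : (nat -> bool) -> X -> Y)
  (G : (nat -> bool) -> X -> nat -> Y -> Y) :
  Comp (fun A p => G A (fst p) (fst (snd p)) (snd (snd p))) -> Comp F -> Comp n ->
  Comp (fun A x => natrec (F A x) (G A x) (n A x)).
Proof.
  intros [g Hg] [f Hf] [d Hd].
  exists (CComp (CRec f g) (CPair (CPair CFst CSnd) d)). intros A x.
  apply run_comp with (u := pair (enc x) (n A x)).
  - apply run_pair; [|apply Hd]. apply run_id.
  - induction (n A x) as [|m IH].
    + apply run_rec0; rewrite ?snd'_pair, ?fst'_pair; [easy|apply Hf].
    + eapply run_recS; rewrite ?snd'_pair, ?fst'_pair; [easy|apply IH|].
      apply (Hg A (x, (m, natrec (F A x) (G A x) m))).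
Qed.

Definition pred_code : code := CComp (CRec CZero (CComp CFst CSnd)) (CPair CZero (CPair CFst CSnd)).

Lemma run_pred_code A n : run A pred_code n (pred n).
Proof.
  apply run_comp with (u := pair 0 n).
  - apply run_pair; [apply run_zero|]. apply run_id.
  - induction n as [|n IH].
    + apply run_rec0; [now rewrite snd'_pair|apply run_zero].
    + eapply run_recS; rewrite ?snd'_pair, ?fst'_pair; [easy|apply IH|].
      eapply run_comp; [apply run_snd_pair|apply run_fst_pair].
Qed.

Definition sgn_code : code :=
  CComp (CRec CZero (CComp CSucc CZero)) (CPair CZero (CPair CFst CSnd)).

Lemma run_sgn_code A n : run A sgn_code n (match n with 0 => 0 | _ => 1 end).
Proof.
  apply run_comp with (u := pair 0 n).
  - apply run_pair; [apply run_zero|]. apply run_id.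
  - induction n as [|n IH].
    + apply run_rec0; [now rewrite snd'_pair|apply run_zero].
    + eapply run_recS; rewrite ?snd'_pair, ?fst'_pair; [easy|apply IH|].
      eapply run_comp; [apply run_zero|apply run_succ].
Qed.

(* The code branches on [F A x] through a recursion of length at most one, so that [G] is only
   evaluated at codes of elements of [Y]. *)
Lemma comp_by_code_cases {X Y Z} {EX : Enc X} {EY : Enc Y} {EZ : Enc Z} (d : (nat -> bool) -> X -> Z)
  (G : (nat -> bool) -> X -> Y -> Z) (F : (nat -> bool) -> X -> nat) (H : (nat -> bool) -> X -> Z) :
  Comp d -> Comp (fun A p => G A (fst p) (snd p)) -> Comp F ->
  (forall A x, (F A x = 0 /\ H A x = d A x) \/ exists y, F A x = S (enc y) /\ H A x = G A x y) ->
  Comp H.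
Proof.
  intros [f Hf] [g Hg] [e He] K.
  set (f' := CComp f CFst).
  set (g' := CComp g (CPair (CComp CFst CFst) (CComp pred_code (CComp CSnd CFst)))).
  exists (CComp (CRec f' g') (CPair (CPair (CPair CFst CSnd) e) (CComp sgn_code e))).
  intros A x. set (n := F A x). set (w := pair (enc x) n).
  apply run_comp with (u := pair w (match n with 0 => 0 | _ => 1 end)).
  { apply run_pair; [apply run_pair; [apply run_id|apply He]|].
    eapply run_comp; [apply He|apply run_sgn_code]. }
  assert (Hfst : run A CFst w (enc x)).
  { apply run_fst_pair. }
  assert (R0 : run A (CRec f' g') (pair w 0) (enc (d A x))).
  { apply run_rec0; rewrite ?snd'_pair, ?fst'_pair; [easy|].
    eapply run_comp; [apply Hfst|apply Hf]. }
  destruct (K A x) as [[E1 E2]|[y [E1 E2]]]; fold n in E1; rewrite E2, E1; [easy|].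
  eapply run_recS; rewrite ?snd'_pair, ?fst'_pair; [reflexivity|apply R0|].
  apply run_comp with (u := enc (x, y)); [|apply (Hg A (x, y))].
  assert (Hw : run A CFst (pair w (pair 0 (enc (d A x)))) w).
  { apply run_fst_pair. }
  apply run_pair; [eapply run_comp; [apply Hw|apply Hfst]|].
  eapply run_comp; [eapply run_comp; [apply Hw|apply run_snd]|].
  unfold w. rewrite snd'_pair, E1. apply run_pred_code.
Qed.

Lemma comp_if {X Y} {EX : Enc X} {EY : Enc Y} (b : (nat -> bool) -> X -> bool)
  (F G : (nat -> bool) -> X -> Y) :
  Comp b -> Comp F -> Comp G -> Comp (fun A x => if b A x then F A x else G A x).
Proof.
  intros [c Hc] [f Hf] [g Hg].
  apply comp_ext with (G := fun A x => natrec (G A x) (fun _ _ => F A x) (if b A x then 1 else 0)).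
  { intros A x. now destruct (b A x). }
  apply (comp_natrec (fun A x => if b A x then 1 else 0) G (fun A x _ _ => F A x)).
  - apply (comp_subst F); [now exists f|]. apply comp_fst, comp_var.
  - now exists g.
  - exists c. intros. apply Hc.
Qed.

Definition ncase {Y} (n : nat) (y : Y) (g : nat -> Y) : Y :=
  match n with 0 => y | S m => g m end.

Lemma comp_ncase {X Y} {EX : Enc X} {EY : Enc Y} (F : (nat -> bool) -> X -> nat)
  (d : (nat -> bool) -> X -> Y) (G : (nat -> bool) -> X -> nat -> Y) :
  Comp (fun A p => G A (fst p) (snd p)) -> Comp F -> Comp d ->
  Comp (fun A x => ncase (F A x) (d A x) (G A x)).
Proof.
  intros H1 H2 H3. eapply comp_by_code_cases with (F := F) (d := d) (G := G); try easy.
  intros A x. destruct (F A x) as [|m]; [now left|right]. now exists m.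
Qed.

Definition ocase {E Y} (o : option E) (y : Y) (g : E -> Y) : Y :=
  match o with None => y | Some a => g a end.

Lemma comp_ocase {X E Y} {EX : Enc X} {EE : Enc E} {EY : Enc Y} (F : (nat -> bool) -> X -> option E)
  (d : (nat -> bool) -> X -> Y) (G : (nat -> bool) -> X -> E -> Y) :
  Comp (fun A p => G A (fst p) (snd p)) -> Comp F -> Comp d ->
  Comp (fun A x => ocase (F A x) (d A x) (G A x)).
Proof.
  intros H1 H2 H3. eapply comp_by_code_cases with (F := fun A x => enc (F A x)) (d := d) (G := G); try easy.
  intros A x. destruct (F A x) as [a|]; [right|now left]. now exists a.
Qed.

Definition lcase {E Y} (l : list E) (y : Y) (g : E -> list E -> Y) : Y :=
  match l with [] => y | a :: t => g a t end.

Lemma comp_lcase {X E Y} {EX : Enc X} {EE : Enc E} {EY : Enc Y} (F : (nat -> bool) -> X -> list E)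
  (d : (nat -> bool) -> X -> Y) (G : (nat -> bool) -> X -> E -> list E -> Y) :
  Comp (fun A p => G A (fst p) (fst (snd p)) (snd (snd p))) -> Comp F -> Comp d ->
  Comp (fun A x => lcase (F A x) (d A x) (G A x)).
Proof.
  intros H1 H2 H3.
  eapply comp_by_code_cases with (F := fun A x => enc (F A x)) (d := d)
    (G := fun A x p => G A x (fst p) (snd p)); try easy.
  intros A x. destruct (F A x) as [|a t]; [now left|right]. now exists (a, t).
Qed.

Lemma comp_Some {X Y} {EX : Enc X} {EY : Enc Y} (F : (nat -> bool) -> X -> Y) :
  Comp F -> Comp (fun A x => Some (F A x)).
Proof. intros [c Hc]. exists (CComp CSucc c). intros. eapply run_comp; [apply Hc|apply run_succ]. Qed.

Lemma comp_cons {X Y} {EX : Enc X} {EY : Enc Y} (F : (nat -> bool) -> X -> Y)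
  (G : (nat -> bool) -> X -> list Y) :
  Comp F -> Comp G -> Comp (fun A x => F A x :: G A x).
Proof.
  intros [c Hc] [d Hd]. exists (CComp CSucc (CPair c d)). intros.
  eapply run_comp; [apply run_pair; [apply Hc|apply Hd]|apply run_succ].
Qed.

(* Automation of computability proofs *)
Create HintDb comp_lib.

Lemma comp_lib_fst {Y Z} {EY : Enc Y} {EZ : Enc Z} : Comp (fun _ (p : Y * Z) => fst p).
Proof. apply comp_fst, comp_var. Qed.
Lemma comp_lib_snd {Y Z} {EY : Enc Y} {EZ : Enc Z} : Comp (fun _ (p : Y * Z) => snd p).
Proof. apply comp_snd, comp_var. Qed.
Lemma comp_lib_S : Comp (fun _ n => S n).
Proof. apply comp_S, comp_var. Qed.
Lemma comp_lib_fst' : Comp (fun _ n => fst' n).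
Proof. apply comp_fst', comp_var. Qed.
Lemma comp_lib_snd' : Comp (fun _ n => snd' n).
Proof. apply comp_snd', comp_var. Qed.
Lemma comp_lib_pair' : Comp (fun _ p => pair (fst p) (snd p)).
Proof. apply comp_pair'; [apply comp_fst, comp_var|apply comp_snd, comp_var]. Qed.
Lemma comp_lib_Some {Y} {EY : Enc Y} : Comp (fun _ (y : Y) => Some y).
Proof. apply comp_Some, comp_var. Qed.
Lemma comp_lib_cons {Y} {EY : Enc Y} : Comp (fun _ (p : Y * list Y) => fst p :: snd p).
Proof. apply comp_cons; [apply comp_fst, comp_var|apply comp_snd, comp_var]. Qed.
Lemma comp_lib_enc {Y} {EY : Enc Y} : Comp (fun _ (y : Y) => enc y).
Proof. exists (CPair CFst CSnd). intros. apply run_id. Qed.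

#[global] Hint Resolve comp_lib_fst comp_lib_snd comp_lib_S comp_lib_fst' comp_lib_snd' comp_lib_pair'
  comp_lib_Some comp_lib_cons comp_lib_enc : comp_lib.

Ltac comp_leaf := first [assumption | solve [auto 1 with comp_lib nocore]].

(** A hook, redefined with [::=] whenever further list combinators have been proved computable. *)
Ltac comp_comb := fail.

Ltac comp1 :=
  cbv beta;
  lazymatch goal with
  | |- Comp (fun A x => x) => apply comp_var
  | |- Comp (fun _ _ => ?y) => apply comp_const
  | |- Comp (fun A x => (@?F A x, @?G A x)) => apply (comp_pair F G)
  | |- Comp (fun A x => if @?b A x then @?F A x else @?G A x) => apply (comp_if b F G)
  | |- Comp (fun A x => ncase (@?F A x) (@?d A x) (@?G A x)) => apply (comp_ncase F d G)
  | |- Comp (fun A x => ocase (@?F A x) (@?d A x) (@?G A x)) => apply (comp_ocase F d G)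
  | |- Comp (fun A x => lcase (@?F A x) (@?d A x) (@?G A x)) => apply (comp_lcase F d G)
  | |- Comp (fun A x => natrec (@?d A x) (@?G A x) (@?n A x)) => apply (comp_natrec n d G)
  | |- _ => first [ assumption | comp_comb | comp_app ]
  end
with comp_app :=
  match goal with
  | |- Comp (fun A x => A (@?F A x)) => apply (comp_oracle F)
  | |- Comp (fun A x => ?f A (@?F A x)) => refine (comp_subst f F _ _); [comp_leaf|]
  | |- Comp (fun A x => ?f A (@?F A x) (@?G A x)) =>
      refine (comp_subst (fun A p => f A (fst p) (snd p)) (fun A x => (F A x, G A x)) _ _);
      [comp_leaf|]
  | |- Comp (fun A x => ?f A (@?F A x) (@?G A x) (@?H A x)) =>
      refine (comp_subst (fun A p => f A (fst p) (fst (snd p)) (snd (snd p)))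
        (fun A x => (F A x, (G A x, H A x))) _ _); [comp_leaf|]
  | |- Comp (fun A x => ?f (@?F A x)) => refine (comp_subst (fun _ y => f y) F _ _); [comp_leaf|]
  | |- Comp (fun A x => ?f (@?F A x) (@?G A x)) =>
      refine (comp_subst (fun _ p => f (fst p) (snd p)) (fun A x => (F A x, G A x)) _ _);
      [comp_leaf|]
  | |- Comp (fun A x => ?f (@?F A x) (@?G A x) (@?H A x)) =>
      refine (comp_subst (fun _ p => f (fst p) (fst (snd p)) (snd (snd p)))
        (fun A x => (F A x, (G A x, H A x))) _ _); [comp_leaf|]
  | |- Comp (fun A x => ?f (@?F A x) (@?G A x) (@?H A x) (@?K A x)) =>
      refine (comp_subst (fun _ p => f (fst p) (fst (snd p)) (fst (snd (snd p))) (snd (snd (snd p))))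
        (fun A x => (F A x, (G A x, (H A x, K A x)))) _ _); [comp_leaf|]
  end.
Ltac comp := repeat comp1.

(** * Computability of list operations and arithmetic *)

Lemma length_le_enc {E} {EE : Enc E} (l : list E) : length l <= enc l.
Proof.
  induction l as [|a l IH]; cbn in *; [lia|]. pose proof (pair_ge (enc a) (enc_list l)). lia.
Qed.

Lemma comp_fold_left {X E Y} {EX : Enc X} {EE : Enc E} {EY : Enc Y}
  (l : (nat -> bool) -> X -> list E) (y : (nat -> bool) -> X -> Y)
  (G : (nat -> bool) -> X -> Y -> E -> Y) :
  Comp (fun A p => G A (fst p) (fst (snd p)) (snd (snd p))) -> Comp l -> Comp y ->
  Comp (fun A x => fold_left (G A x) (l A x) (y A x)).
Proof.
  intros H1 H2 H3.
  apply comp_ext with (G := fun A x => fst (natrec (y A x, l A x)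
    (fun _ s => lcase (snd s) s (fun a t => (G A x (fst s) a, t))) (enc (l A x)))).
  - intros A x.
    assert (K : forall n y l, length l <= n ->
      natrec (y, l) (fun _ s => lcase (snd s) s (fun a t => (G A x (fst s) a, t))) n
      = (fold_left (G A x) l y, [])).
    { induction n as [|n IH]; intros y0 l0 L; [now destruct l0; cbn in *; [|lia]|].
      assert (Q : forall n s, natrec s (fun _ s => lcase (snd s) s (fun a t => (G A x (fst s) a, t))) (S n)
        = natrec (lcase (snd s) s (fun a t => (G A x (fst s) a, t)))
            (fun _ s => lcase (snd s) s (fun a t => (G A x (fst s) a, t))) n).
      { clear. induction n as [|n IH]; intros s; [reflexivity|]. cbn [natrec] in *. now rewrite IH. }
      rewrite Q. destruct l0 as [|a l0]; cbn [lcase snd fst fold_left].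
      - apply (IH y0 []). cbn. lia.
      - apply IH. cbn in L. lia. }
    rewrite K; [reflexivity|apply length_le_enc].
  - comp.
Qed.
Lemma comp_rev {E} {EE : Enc E} : Comp (fun _ (l : list E) => rev l).
Proof.
  refine (comp_ext _ (fun _ l => fold_left (fun acc a => a :: acc) l []) _ _).
  - intros _ l. rewrite <- fold_left_rev_right, <- (rev_involutive (rev l)), rev_involutive.
    induction (rev l) as [|a t IH]; [reflexivity|]. cbn. now f_equal.
  - apply comp_fold_left; comp.
Qed.
#[global] Hint Resolve comp_rev : comp_lib.

Fixpoint listrec {E Y} (y : Y) (g : E -> list E -> Y -> Y) (l : list E) : Y :=
  match l with [] => y | a :: t => g a t (listrec y g t) end.

(** Structural recursion is a left fold over the reversed list that carries along the tail rebuilt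
    so far, so that [G] can see it. *)
Lemma comp_listrec {X E Y} {EX : Enc X} {EE : Enc E} {EY : Enc Y}
  (l : (nat -> bool) -> X -> list E) (y : (nat -> bool) -> X -> Y)
  (G : (nat -> bool) -> X -> E -> list E -> Y -> Y) :
  Comp (fun A p => G A (fst p) (fst (snd p)) (fst (snd (snd p))) (snd (snd (snd p)))) ->
  Comp l -> Comp y ->
  Comp (fun A x => listrec (y A x) (G A x) (l A x)).
Proof.
  intros H1 H2 H3.
  apply comp_ext with (G := fun A x =>
    snd (fold_left (fun s a => (a :: fst s, G A x a (fst s) (snd s))) (rev (l A x)) ([], y A x))).
  - intros A x.
    assert (K : fold_left (fun s a => (a :: fst s, G A x a (fst s) (snd s))) (rev (l A x)) ([], y A x)
      = (l A x, listrec (y A x) (G A x) (l A x))).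
    { induction (l A x) as [|a t IH]; [reflexivity|]. cbn [rev listrec].
      rewrite fold_left_app, IH. reflexivity. }
    now rewrite K.
  - apply comp_snd. apply comp_fold_left; comp.
    refine (comp_subst (fun A p => G A (fst p) (fst (snd p)) (fst (snd (snd p))) (snd (snd (snd p))))
      (fun A p => (fst p, (snd (snd p), (fst (fst (snd p)), snd (fst (snd p)))))) _ _); comp.
Qed.

Ltac comp_comb ::=
  lazymatch goal with
  | |- Comp (fun A x => fold_left (@?G A x) (@?l A x) (@?d A x)) => apply (comp_fold_left l d G)
  | |- Comp (fun A x => listrec (@?d A x) (@?G A x) (@?l A x)) => apply (comp_listrec l d G)
  end.

Lemma comp_map {X E Y} {EX : Enc X} {EE : Enc E} {EY : Enc Y}
  (l : (nat -> bool) -> X -> list E) (G : (nat -> bool) -> X -> E -> Y) :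
  Comp (fun A p => G A (fst p) (snd p)) -> Comp l -> Comp (fun A x => map (G A x) (l A x)).
Proof.
  intros H1 H2. apply comp_ext with (G := fun A x => listrec [] (fun a _ r => G A x a :: r) (l A x)).
  - intros A x. induction (l A x) as [|a t IH]; [reflexivity|]. cbn. now f_equal.
  - comp.
Qed.

Lemma comp_filter {X E} {EX : Enc X} {EE : Enc E}
  (l : (nat -> bool) -> X -> list E) (G : (nat -> bool) -> X -> E -> bool) :
  Comp (fun A p => G A (fst p) (snd p)) -> Comp l -> Comp (fun A x => filter (G A x) (l A x)).
Proof.
  intros H1 H2. apply comp_ext
    with (G := fun A x => listrec [] (fun a _ r => if G A x a then a :: r else r) (l A x)).
  - intros A x. induction (l A x) as [|a t IH]; [reflexivity|]. cbn. now rewrite IH.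
  - comp.
Qed.

Lemma comp_app2 {E} {EE : Enc E} : Comp (fun _ (p : list E * list E) => fst p ++ snd p).
Proof.
  refine (comp_ext _ (fun _ p => listrec (snd p) (fun a _ r => a :: r) (fst p)) _ _).
  - intros _ [l m]. cbn. induction l as [|a t IH]; [reflexivity|]. cbn. now f_equal.
  - comp.
Qed.
#[global] Hint Resolve comp_app2 : comp_lib.

Lemma comp_flat_map {X E Y} {EX : Enc X} {EE : Enc E} {EY : Enc Y}
  (l : (nat -> bool) -> X -> list E) (G : (nat -> bool) -> X -> E -> list Y) :
  Comp (fun A p => G A (fst p) (snd p)) -> Comp l -> Comp (fun A x => flat_map (G A x) (l A x)).
Proof.
  intros H1 H2. apply comp_ext with (G := fun A x => listrec [] (fun a _ r => G A x a ++ r) (l A x)).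
  - intros A x. induction (l A x) as [|a t IH]; [reflexivity|]. cbn. now f_equal.
  - comp.
Qed.

Lemma comp_existsb {X E} {EX : Enc X} {EE : Enc E}
  (l : (nat -> bool) -> X -> list E) (G : (nat -> bool) -> X -> E -> bool) :
  Comp (fun A p => G A (fst p) (snd p)) -> Comp l -> Comp (fun A x => existsb (G A x) (l A x)).
Proof.
  intros H1 H2. apply comp_ext
    with (G := fun A x => listrec false (fun a _ r => if G A x a then true else r) (l A x)).
  - intros A x. induction (l A x) as [|a t IH]; [reflexivity|]. cbn. now rewrite IH.
  - comp.
Qed.

Lemma comp_forallb {X E} {EX : Enc X} {EE : Enc E}
  (l : (nat -> bool) -> X -> list E) (G : (nat -> bool) -> X -> E -> bool) :
  Comp (fun A p => G A (fst p) (snd p)) -> Comp l -> Comp (fun A x => forallb (G A x) (l A x)).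
Proof.
  intros H1 H2. apply comp_ext
    with (G := fun A x => listrec true (fun a _ r => if G A x a then r else false) (l A x)).
  - intros A x. induction (l A x) as [|a t IH]; [reflexivity|]. cbn. now rewrite IH.
  - comp.
Qed.

Lemma comp_find {X E} {EX : Enc X} {EE : Enc E}
  (l : (nat -> bool) -> X -> list E) (G : (nat -> bool) -> X -> E -> bool) :
  Comp (fun A p => G A (fst p) (snd p)) -> Comp l -> Comp (fun A x => find (G A x) (l A x)).
Proof.
  intros H1 H2. apply comp_ext
    with (G := fun A x => listrec None (fun a _ r => if G A x a then Some a else r) (l A x)).
  - intros A x. induction (l A x) as [|a t IH]; [reflexivity|]. cbn. now rewrite IH.
  - comp.
Qed.

Ltac comp_comb ::=
  lazymatch goal with
  | |- Comp (fun A x => fold_left (@?G A x) (@?l A x) (@?d A x)) => apply (comp_fold_left l d G)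
  | |- Comp (fun A x => listrec (@?d A x) (@?G A x) (@?l A x)) => apply (comp_listrec l d G)
  | |- Comp (fun A x => map (@?G A x) (@?l A x)) => apply (comp_map l G)
  | |- Comp (fun A x => filter (@?G A x) (@?l A x)) => apply (comp_filter l G)
  | |- Comp (fun A x => flat_map (@?G A x) (@?l A x)) => apply (comp_flat_map l G)
  | |- Comp (fun A x => existsb (@?G A x) (@?l A x)) => apply (comp_existsb l G)
  | |- Comp (fun A x => forallb (@?G A x) (@?l A x)) => apply (comp_forallb l G)
  | |- Comp (fun A x => find (@?G A x) (@?l A x)) => apply (comp_find l G)
  end.

Lemma comp_pred : Comp (fun _ n => pred n).
Proof.
  refine (comp_ext _ (fun _ n => ncase n 0 (fun m => m)) _ _); [now intros _ []|]. comp.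
Qed.

Lemma comp_add : Comp (fun _ (p : nat * nat) => fst p + snd p).
Proof.
  refine (comp_ext _ (fun _ p => natrec (snd p) (fun _ r => S r) (fst p)) _ _); [|comp].
  intros _ [a b]. cbn. induction a as [|a IH]; [reflexivity|]. cbn. now f_equal.
Qed.
#[global] Hint Resolve comp_pred comp_add : comp_lib.

Lemma comp_mul : Comp (fun _ (p : nat * nat) => fst p * snd p).
Proof.
  refine (comp_ext _ (fun _ p => natrec 0 (fun _ r => snd p + r) (fst p)) _ _); [|comp].
  intros _ [a b]. cbn [fst snd]. induction a as [|a IH]; [reflexivity|]. cbn. now f_equal.
Qed.

Lemma comp_sub : Comp (fun _ (p : nat * nat) => fst p - snd p).
Proof.
  refine (comp_ext _ (fun _ p => natrec (fst p) (fun _ r => pred r) (snd p)) _ _); [|comp].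
  intros _ [a b]. cbn [fst snd]. induction b as [|b IH]; cbn; [lia|]. rewrite <- IH. lia.
Qed.
#[global] Hint Resolve comp_mul comp_sub : comp_lib.

Lemma comp_pow : Comp (fun _ (p : nat * nat) => fst p ^ snd p).
Proof.
  refine (comp_ext _ (fun _ p => natrec 1 (fun _ r => fst p * r) (snd p)) _ _); [|comp].
  intros _ [a b]. cbn [fst snd]. induction b as [|b IH]; [reflexivity|]. cbn. now rewrite IH.
Qed.

Lemma comp_leb : Comp (fun _ (p : nat * nat) => fst p <=? snd p).
Proof.
  refine (comp_ext _ (fun _ p => ncase (fst p - snd p) true (fun _ => false)) _ _); [|comp].
  intros _ [a b]. cbn [fst snd]. destruct (Nat.leb_spec a b).
  - now replace (a - b) with 0 by lia.
  - destruct (a - b) eqn:?; [lia|reflexivity].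
Qed.

Lemma comp_andb : Comp (fun _ (p : bool * bool) => fst p && snd p).
Proof.
  refine (comp_ext _ (fun _ (p : bool * bool) => if fst p then snd p else false) _ _); [now intros _ [[] []]|comp].
Qed.

Lemma comp_orb : Comp (fun _ (p : bool * bool) => fst p || snd p).
Proof.
  refine (comp_ext _ (fun _ (p : bool * bool) => if fst p then true else snd p) _ _); [now intros _ [[] []]|comp].
Qed.

Lemma comp_negb : Comp (fun _ b => negb b).
Proof.
  refine (comp_ext _ (fun _ (b : bool) => if b then false else true) _ _); [now intros _ []|comp].
Qed.

Lemma comp_eqbool : Comp (fun _ (p : bool * bool) => Bool.eqb (fst p) (snd p)).
Proof.
  refine (comp_ext _ (fun _ (p : bool * bool) => if fst p then snd p else if snd p then false else true) _ _);
    [now intros _ [[] []]|comp].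
Qed.
#[global] Hint Resolve comp_pow comp_leb comp_andb comp_orb comp_negb comp_eqbool : comp_lib.

Lemma comp_eqb : Comp (fun _ (p : nat * nat) => fst p =? snd p).
Proof.
  refine (comp_ext _ (fun _ p => (fst p <=? snd p) && (snd p <=? fst p)) _ _); [|comp].
  intros _ [a b]. cbn [fst snd].
  destruct (Nat.eqb_spec a b), (Nat.leb_spec a b), (Nat.leb_spec b a); trivial; lia.
Qed.

Lemma comp_max : Comp (fun _ (p : nat * nat) => Nat.max (fst p) (snd p)).
Proof.
  refine (comp_ext _ (fun _ p => fst p + (snd p - fst p)) _ _); [|comp].
  intros _ [a b]. cbn [fst snd]. lia.
Qed.

Lemma comp_min2 : Comp (fun _ (p : nat * nat) => Nat.min (fst p) (snd p)).
Proof.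
  refine (comp_ext _ (fun _ p => fst p - (fst p - snd p)) _ _); [|comp].
  intros _ [a b]. cbn [fst snd]. lia.
Qed.

Lemma comp_seq0 : Comp (fun _ n => seq 0 n).
Proof.
  refine (comp_ext _ (fun _ n => natrec [] (fun m r => r ++ [m]) n) _ _); [|comp].
  intros _ n. induction n as [|n IH]; [reflexivity|]. rewrite seq_S, IH. reflexivity.
Qed.

Lemma comp_length {E} {EE : Enc E} : Comp (fun _ (l : list E) => length l).
Proof.
  refine (comp_ext _ (fun _ l => listrec 0 (fun _ _ r => S r) l) _ _); [|comp].
  intros _ l. induction l as [|a l IH]; [reflexivity|]. cbn. now f_equal.
Qed.

Lemma comp_tl {E} {EE : Enc E} : Comp (fun _ (l : list E) => tl l).
Proof.
  refine (comp_ext _ (fun _ l => lcase l [] (fun _ t => t)) _ _); [now intros _ []|comp].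
Qed.

Lemma comp_hd {E} {EE : Enc E} : Comp (fun _ (p : E * list E) => hd (fst p) (snd p)).
Proof.
  refine (comp_ext _ (fun _ p => lcase (snd p) (fst p) (fun a _ => a)) _ _);
    [now intros _ [? []]|comp].
Qed.
#[global] Hint Resolve comp_eqb comp_max comp_min2 comp_seq0 comp_length comp_tl comp_hd : comp_lib.

Lemma tl_iter {E} n (l : list E) : natrec l (fun _ r => tl r) n = skipn n l.
Proof.
  induction n as [|n IH]; [reflexivity|]. cbn [natrec]. rewrite IH. clear IH.
  revert l. induction n as [|n IH]; intros [|a l]; try reflexivity. apply IH.
Qed.

Lemma comp_nth_error {E} {EE : Enc E} : Comp (fun _ (p : list E * nat) => nth_error (fst p) (snd p)).
Proof.
  apply comp_ext with (G := fun _ p =>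
    lcase (natrec (fst p) (fun _ r => tl r) (snd p)) None (fun a _ => Some a)); [|comp].
  intros _ [l n]. cbn [fst snd]. rewrite tl_iter. revert l.
  induction n as [|n IH]; intros [|a l]; try reflexivity. apply IH.
Qed.
#[global] Hint Resolve comp_nth_error : comp_lib.

Lemma comp_nth {E} {EE : Enc E} :
  Comp (fun _ (p : nat * (list E * E)) => nth (fst p) (fst (snd p)) (snd (snd p))).
Proof.
  apply comp_ext with (G := fun _ p =>
    ocase (nth_error (fst (snd p)) (fst p)) (snd (snd p)) (fun a => a)); [|comp].
  intros _ [n [l d]]. cbn [fst snd]. revert l.
  induction n as [|n IH]; intros [|a l]; try reflexivity. apply IH.
Qed.
#[global] Hint Resolve comp_nth : comp_lib.

Definition ebeq {X} {EX : Enc X} (x y : X) : bool := enc x =? enc y.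

Lemma ebeq_eq {X} {EX : Enc X} (x y : X) : ebeq x y = true -> x = y.
Proof. unfold ebeq. rewrite Nat.eqb_eq. apply enc_inj. Qed.

Lemma ebeq_refl {X} {EX : Enc X} (x : X) : ebeq x x = true.
Proof. apply Nat.eqb_refl. Qed.

Lemma comp_ebeq {X} {EX : Enc X} : Comp (fun _ (p : X * X) => ebeq (fst p) (snd p)).
Proof. unfold ebeq. comp. Qed.
#[global] Hint Resolve comp_ebeq : comp_lib.

(** * Unbounded search *)

(** Nothing effective is assumed about [mu] itself, so a function obtained by choice becomes
    computable once its values are least solutions of a computable condition. *)
Lemma comp_least {X} {EX : Enc X} (P : (nat -> bool) -> X -> nat -> bool)
  (mu : (nat -> bool) -> X -> nat) :
  Comp (fun A p => P A (fst p) (snd p)) ->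
  (forall A x, P A x (mu A x) = true /\ forall j, j < mu A x -> P A x j = false) -> Comp mu.
Proof.
  intros H K. assert (H' : Comp (fun A p => if P A (fst p) (snd p) then 0 else 1)) by comp.
  destruct H' as [c Hc]. exists (CMin c). intros A x. destruct (K A x) as [K1 K2].
  apply run_min with (v := fun j => if P A x j then 0 else 1); [| |cbn; now rewrite K1].
  - intros j _. apply (Hc A (x, j)).
  - intros j L. now rewrite (K2 j L).

Qed.

(** Turns a semidecidable condition into the domain of a code; it yields both the index of the class
    and the indices of the finite trace sets. *)
Lemma halting_code {X} {EX : Enc X} (P : (nat -> bool) -> X -> nat -> bool) :
  Comp (fun A p => P A (fst p) (snd p)) ->
  exists c, forall A x, (exists y, run A c (enc x) y) <-> exists n, P A x n = true.
Proof.
  intros H. assert (H' : Comp (fun A p => if P A (fst p) (snd p) then 0 else 1)) by comp.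
  destruct H' as [c Hc]. exists (CMin c). intros A x. split.
  - intros [y Hy]. apply run_min_inv in Hy. exists y.
    pose proof (run_det _ _ _ _ _ Hy (Hc A (x, y))) as E. cbn in E.
    destruct (P A x y); [reflexivity|discriminate].
  - intros [n Hn]. induction n as [n IH] using lt_wf_ind.
    destruct (existsb (P A x) (seq 0 n)) eqn:E.
    + apply existsb_exists in E as [m [Lm Pm]]. apply in_seq in Lm. apply (IH m); [lia|easy].
    + exists n. apply run_min with (v := fun j => if P A x j then 0 else 1); [| |now rewrite Hn].
      * intros j _. apply (Hc A (x, j)).
      * intros j L Z. destruct (P A x j) eqn:Pj; [|discriminate].
        enough (existsb (P A x) (seq 0 n) = true) by congruence.
        apply existsb_exists. exists j. rewrite in_seq. split; [lia|easy].

Qed.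

Lemma Comp_computable (f : nat -> nat) : Comp (fun _ n => f n) -> computable f.
Proof.
  intros [c Hc]. exists (encode c). intros x. unfold phi, Phi. rewrite decode_encode. apply Hc.
Qed.

Lemma Comp_computable2 (g : nat -> nat -> nat) :
  Comp (fun _ (p : nat * nat) => g (fst p) (snd p)) -> computable2 g.
Proof.
  intros H. apply Comp_computable.
  apply (comp_subst (fun _ (p : nat * nat) => g (fst p) (snd p)) (fun _ p => (fst' p, snd' p))); [easy|comp].
Qed.

(** * A computable approximation to the universal functional *)

(* A table of triples [((e, x), y)] certifies computations: each triple must follow from the
   later ones by one rule of the semantics, and only the oracle values listed in [s] may be used. *)
Definition table : Type := list (nat * nat * nat).

Definition listed (T : table) (e x y : nat) : bool := existsb (ebeq (e, x, y)) T.

(** One clause per tag read by [decode_S]. An oracle query beyond the end of the string is never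
    justified, so certificates survive every extension of the string. *)
Definition justified (s : list bool) (T : table) (e x y : nat) : bool :=
  ncase e (y =? 0) (fun m =>
    if fst' m =? 0 then y =? S x
    else if fst' m =? 1 then y =? fst' x
    else if fst' m =? 2 then y =? snd' x
    else if fst' m =? 3 then
      ocase (nth_error s x) false (fun b => y =? (if b then 1 else 0))
    else if fst' m =? 4 then
      listed T (fst' (snd' m)) x (fst' y) && listed T (snd' (snd' m)) x (snd' y)
    else if fst' m =? 5 then
      existsb (fun w => ebeq (fst w) (snd' (snd' m), x) && listed T (fst' (snd' m)) (snd w) y) T
    else if fst' m =? 6 then
      ncase (snd' x) (listed T (fst' (snd' m)) (fst' x) y) (fun n =>
        existsb (fun w => ebeq (fst w) (e, pair (fst' x) n)
          && listed T (snd' (snd' m)) (pair (fst' x) (pair n (snd w))) y) T)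
    else if fst' m =? 7 then
      listed T (snd' m) (pair x y) 0
      && forallb (fun j => existsb (fun w => ebeq (fst w) (snd' m, pair x j) && negb (snd w =? 0)) T)
           (seq 0 y)
    else y =? 0).

Definition valid (s : list bool) (T : table) : bool :=
  listrec true (fun w T' r => r && justified s T' (fst (fst w)) (snd (fst w)) (snd w)) T.

Fixpoint table_of_fuel (f n : nat) : table :=
  match f, n with
  | S f', S m => (fst' (fst' (fst' m)), snd' (fst' (fst' m)), snd' (fst' m)) :: table_of_fuel f' (snd' m)
  | _, _ => []
  end.

(** The inverse of [enc] on tables, for which every number is a code; it lets [facts] run through
    all tables of small code. *)
Definition table_of (n : nat) : table := table_of_fuel n n.

(** The length of [s] bounds both the codes of the tables tried and the oracle bits used. Hence [Ev]
    is total and computable, and longer strings only add facts. *)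
Definition facts (s : list bool) : table :=
  flat_map (fun m => if valid s (table_of m) then table_of m else []) (seq 0 (length s)).

Definition Ev (s : list bool) (e x : nat) : option nat :=
  ocase (find (fun w => ebeq (fst w) (e, x)) (facts s)) None (fun w => Some (snd w)).

Definition restr (A : nat -> bool) (n : nat) : list bool := map A (seq 0 n).

Lemma enc_table_of_fuel f : forall n, n <= f -> enc (table_of_fuel f n) = n.
Proof.
  induction f as [|f IH]; intros [|m] L; try reflexivity; [lia|].
  pose proof (pair_ge (fst' m) (snd' m)) as H. rewrite pair_fst_snd in H.
  cbn -[enc]. change (S (pair (enc (fst' (fst' (fst' m)), snd' (fst' (fst' m)), snd' (fst' m)))
    (enc (table_of_fuel f (snd' m)))) = S m).
  rewrite IH by lia. cbn. now rewrite !pair_fst_snd.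
Qed.

Lemma enc_table_of n : enc (table_of n) = n.
Proof. now apply enc_table_of_fuel. Qed.

Lemma table_of_enc T : table_of (enc T) = T.
Proof. apply enc_inj, enc_table_of. Qed.

Lemma comp_table_of : Comp (fun _ n => table_of n).
Proof. exists (CPair CFst CSnd). intros A n. rewrite enc_table_of. apply run_id. Qed.
#[global] Hint Resolve comp_table_of : comp_lib.

Lemma comp_listed :
  Comp (fun _ (p : table * (nat * (nat * nat))) =>
    listed (fst p) (fst (snd p)) (fst (snd (snd p))) (snd (snd (snd p)))).
Proof. unfold listed, table. comp. Qed.
#[global] Hint Resolve comp_listed : comp_lib.

Lemma comp_justified :
  Comp (fun _ (p : (list bool * table) * (nat * (nat * nat))) =>
    justified (fst (fst p)) (snd (fst p)) (fst (snd p)) (fst (snd (snd p))) (snd (snd (snd p)))).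
Proof. unfold justified, table. comp. Qed.

Lemma comp_valid : Comp (fun _ (p : list bool * table) => valid (fst p) (snd p)).
Proof.
  unfold valid, table. comp.
  refine (comp_subst _ (fun _ p => ((fst (fst p), fst (snd (snd p))),
    (fst (fst (fst (snd p))), (snd (fst (fst (snd p))), snd (fst (snd p)))))) comp_justified _).
  unfold table. comp.
Qed.
#[global] Hint Resolve comp_valid : comp_lib.

Lemma comp_facts : Comp (fun _ s => facts s).
Proof. unfold facts. comp. Qed.
#[global] Hint Resolve comp_facts : comp_lib.

Lemma comp_Ev :
  Comp (fun _ (p : list bool * (nat * nat)) => Ev (fst p) (fst (snd p)) (snd (snd p))).
Proof. unfold Ev. comp. Qed.
#[global] Hint Resolve comp_Ev : comp_lib.

Lemma comp_restr : Comp (fun A n => restr A n).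
Proof. unfold restr. comp. Qed.

(** * Soundness and monotonicity of certificates *)

Lemma listed_iff T e x y : listed T e x y = true <-> In (e, x, y) T.
Proof.
  unfold listed. rewrite existsb_exists. split.
  - intros [w [I E]]. apply ebeq_eq in E. now subst.
  - intros I. exists (e, x, y). split; [exact I|apply ebeq_refl].
Qed.

Lemma valid_cons s w T : valid s (w :: T) = valid s T && justified s T (fst (fst w)) (snd (fst w)) (snd w).
Proof. reflexivity. Qed.

Definition extends (A : nat -> bool) (s : list bool) : Prop :=
  forall i b, nth_error s i = Some b -> A i = b.

Definition truth (A : nat -> bool) (w : nat * nat * nat) : Prop :=
  run A (decode (fst (fst w))) (snd (fst w)) (snd w).

Lemma decode_0 : decode 0 = CZero.
Proof. reflexivity. Qed.

Lemma justified_sound A s T e x y :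
  extends A s -> (forall w, In w T -> truth A w) -> justified s T e x y = true ->
  run A (decode e) x y.
Proof.
  intros Hs HT. unfold justified.
  assert (HL : forall e x y, listed T e x y = true -> run A (decode e) x y).
  { intros e' x' y' L. apply listed_iff in L. apply (HT _ L). }
  destruct e as [|m]; unfold ncase at 1.
  { intros E. apply Nat.eqb_eq in E. subst. rewrite decode_0. apply run_zero. }
  rewrite decode_S. cbv zeta.
  destruct (fst' m) as [|[|[|[|[|[|[|[|t]]]]]]]] eqn:Em; cbn [Nat.eqb]; intros E.
  - apply Nat.eqb_eq in E. subst. apply run_succ.
  - apply Nat.eqb_eq in E. subst. apply run_fst.
  - apply Nat.eqb_eq in E. subst. apply run_snd.
  - destruct (nth_error s x) as [b|] eqn:N; [|discriminate]. cbn in E.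
    apply Nat.eqb_eq in E. subst. apply Hs in N. rewrite <- N. apply run_oracle.
  - apply andb_true_iff in E as [E1 E2]. rewrite <- (pair_fst_snd y). apply run_pair; auto.
  - apply existsb_exists in E as [[[e' x'] u] [I E]]. apply andb_true_iff in E as [E1 E2].
    apply ebeq_eq in E1. cbn in E1, E2. injection E1 as -> ->.
    apply run_comp with (u := u); [apply (HT _ I)|auto].
  - destruct (snd' x) as [|n] eqn:Ex; cbn [ncase] in E.
    + apply run_rec0; auto.
    + apply existsb_exists in E as [[[e' x'] u] [I E]]. apply andb_true_iff in E as [E1 E2].
      apply ebeq_eq in E1. cbn [fst snd] in E1, E2. injection E1 as -> ->.
      eapply run_recS; [exact Ex| |apply HL, E2].
      pose proof (HT _ I) as Ht. unfold truth in Ht. cbn [fst snd] in Ht.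
      rewrite decode_S, Em in Ht. exact Ht.
  - apply andb_true_iff in E as [E1 E2]. rewrite forallb_forall in E2.
    assert (K : forall n, n <= y -> exists v, forall j, j < n ->
      run A (decode (snd' m)) (pair x j) (v j) /\ v j <> 0).
    { induction n as [|n IHn]; intros L; [exists (fun _ => 0); intros; lia|].
      destruct IHn as [v Hv]; [lia|]. specialize (E2 n). rewrite in_seq in E2.
      specialize (E2 ltac:(lia)). apply existsb_exists in E2 as [[[e' x'] u] [I E]].
      apply andb_true_iff in E as [E3 E4]. apply ebeq_eq in E3. cbn in E3, E4.
      injection E3 as -> ->. exists (fun j => if j =? n then u else v j). intros j Lj.
      destruct (Nat.eqb_spec j n) as [->|]; [|apply Hv; lia].
      split; [apply (HT _ I)|]. now destruct u. }
    destruct (K y (le_n y)) as [v Hv].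
    apply run_min with (v := fun j => if j =? y then 0 else v j).
    + intros j Lj. destruct (Nat.eqb_spec j y) as [->|]; [auto|apply Hv; lia].
    + intros j Lj. destruct (Nat.eqb_spec j y) as [->|]; [lia|apply Hv; lia].
    + now rewrite Nat.eqb_refl.
  - apply Nat.eqb_eq in E. subst. apply run_zero.
Qed.

Lemma valid_sound A s T : extends A s -> valid s T = true -> forall w, In w T -> truth A w.
Proof.
  intros Hs. induction T as [|w0 T IH]; intros V w; [easy|].
  rewrite valid_cons in V. apply andb_true_iff in V as [V1 V2].
  intros [<-|I]; [|now apply IH]. eapply justified_sound; eauto.
Qed.

Lemma facts_sound A s w : extends A s -> In w (facts s) -> truth A w.
Proof.
  intros Hs I. apply in_flat_map in I as [m [_ I]].
  destruct (valid s (table_of m)) eqn:V; [|easy]. eapply valid_sound; eauto.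
Qed.

Lemma Ev_in_facts s e x y : Ev s e x = Some y -> In (e, x, y) (facts s).
Proof.
  unfold Ev. destruct (find _ _) as [w|] eqn:F; [|discriminate]. cbn. intros [= <-].
  apply find_some in F as [I E]. apply ebeq_eq in E. rewrite <- E. now destruct w as [[] ].
Qed.

Lemma Ev_sound A s e x y : extends A s -> Ev s e x = Some y -> run A (decode e) x y.
Proof. intros Hs H. apply Ev_in_facts in H. apply (facts_sound A s _ Hs H). Qed.

Lemma facts_Ev A s e x y : extends A s -> In (e, x, y) (facts s) -> Ev s e x = Some y.
Proof.
  intros Hs I. destruct (Ev s e x) as [z|] eqn:E.
  - f_equal. eapply run_det; [eapply Ev_sound; eauto|]. apply (facts_sound A s _ Hs I).
  - exfalso. unfold Ev in E. destruct (find _ _) as [w|] eqn:F; [discriminate|].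
    apply find_none with (x := (e, x, y)) in F; [|easy]. rewrite ebeq_refl in F. discriminate.
Qed.

Lemma listed_incl T T' e x y : incl T T' -> listed T e x y = true -> listed T' e x y = true.
Proof. intros H. rewrite !listed_iff. apply H. Qed.

Lemma existsb_incl {X} (f : X -> bool) g T T' : incl T T' ->
  (forall w, f w = true -> g w = true) -> existsb f T = true -> existsb g T' = true.
Proof.
  intros H K. rewrite !existsb_exists. intros [w [I E]]. exists w. auto.
Qed.

Lemma justified_mono s s' T T' e x y :
  (forall i b, nth_error s i = Some b -> nth_error s' i = Some b) -> incl T T' ->
  justified s T e x y = true -> justified s' T' e x y = true.
Proof.
  intros Hs HT. unfold justified. destruct e as [|m]; [easy|]. unfold ncase at 1 3.
  destruct (fst' m) as [|[|[|[|[|[|[|[|t]]]]]]]] eqn:Em; cbn [Nat.eqb]; auto.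
  - destruct (nth_error s x) as [b|] eqn:E; [|discriminate]. now rewrite (Hs _ _ E).
  - rewrite !andb_true_iff. intros []. split; eapply listed_incl; eauto.
  - apply existsb_incl; [easy|]. intros w. rewrite !andb_true_iff.
    intros []. split; [easy|]. eapply listed_incl; eauto.
  - destruct (snd' x); cbn [ncase]; [now apply listed_incl|].
    apply existsb_incl; [easy|]. intros w. rewrite !andb_true_iff.
    intros []. split; [easy|]. eapply listed_incl; eauto.
  - rewrite !andb_true_iff, !forallb_forall. intros [H1 H2].
    split; [eapply listed_incl; eauto|]. intros j Hj. specialize (H2 j Hj).
    revert H2. now apply existsb_incl.
Qed.

Lemma valid_mono s s' T : (forall i b, nth_error s i = Some b -> nth_error s' i = Some b) ->
  valid s T = true -> valid s' T = true.
Proof.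
  intros H. induction T as [|w T IH]; [easy|]. rewrite !valid_cons, !andb_true_iff.
  intros []. split; [auto|]. eapply justified_mono; eauto. apply incl_refl.
Qed.

(** Triples further down the list are the premises, and additional premises never spoil a
    justification. *)
Lemma valid_app s T T' : valid s T = true -> valid s T' = true -> valid s (T ++ T') = true.
Proof.
  intros H H'. induction T as [|w T IH]; [easy|]. cbn [app]. rewrite valid_cons in *.
  apply andb_true_iff in H as [H1 H2]. apply andb_true_iff. split; [auto|].
  eapply justified_mono; eauto. now apply incl_appl.
Qed.

Lemma facts_mono s t w : In w (facts s) -> In w (facts (s ++ t)).
Proof.
  unfold facts. rewrite !in_flat_map. intros [m [Lm I]]. exists m.
  rewrite in_seq in *. rewrite length_app. split; [lia|].
  destruct (valid s (table_of m)) eqn:V; [|easy].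
  rewrite (valid_mono s (s ++ t)); [easy| |easy].
  intros i b H. rewrite nth_error_app1; [easy|]. apply nth_error_Some. congruence.
Qed.

Lemma extends_nth s : extends (fun i => nth i s false) s.
Proof. intros i b H. now apply nth_error_nth. Qed.

(** Uniqueness of the value needs an actual oracle; the longer string padded with [false] supplies
    one. *)
Lemma Ev_app s t e x y : Ev s e x = Some y -> Ev (s ++ t) e x = Some y.
Proof.
  intros H. apply (facts_Ev _ _ _ _ _ (extends_nth _)), facts_mono, Ev_in_facts, H.
Qed.

Lemma restr_length A n : length (restr A n) = n.
Proof. unfold restr. now rewrite length_map, length_seq. Qed.

Lemma nth_error_restr A n i : nth_error (restr A n) i = if i <? n then Some (A i) else None.
Proof.
  unfold restr. rewrite nth_error_map, nth_error_seq. now destruct (i <? n).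
Qed.

Lemma extends_restr A n : extends A (restr A n).
Proof. intros i b. rewrite nth_error_restr. destruct (i <? n); congruence. Qed.

(** * Completeness of certificates *)

Definition certifies (A : nat -> bool) (e x y : nat) (N : nat) (T : table) : Prop :=
  In (e, x, y) T /\ valid (restr A N) T = true.

Lemma restr_le A n m i b : n <= m ->
  nth_error (restr A n) i = Some b -> nth_error (restr A m) i = Some b.
Proof.
  intros L. rewrite !nth_error_restr. destruct (Nat.ltb_spec i n), (Nat.ltb_spec i m); easy || lia.
Qed.

Lemma valid_restr_le A n m T : n <= m -> valid (restr A n) T = true -> valid (restr A m) T = true.
Proof. intros L. apply valid_mono. intros. eapply restr_le; eauto. Qed.

Lemma valid_restr_app A n m T T' : valid (restr A n) T = true -> valid (restr A m) T' = true ->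
  valid (restr A (n + m)) (T ++ T') = true.
Proof.
  intros H H'. apply valid_app; eapply valid_restr_le; try eassumption; lia.
Qed.

Lemma certifies_intro A e x y N T : valid (restr A N) T = true ->
  justified (restr A N) T e x y = true -> exists N T, certifies A e x y N T.
Proof.
  intros V J. exists N, ((e, x, y) :: T). split; [now left|].
  rewrite valid_cons, V. exact J.
Qed.

(** Induction on the fuel: certificates of the subcomputations are concatenated and the new triple
    is put in front. *)
Lemma certificate_exists A s : forall e x y, eval s A (decode e) x = Some y ->
  exists N T, certifies A e x y N T.
Proof.
  induction s as [|s IH]; intros e x y H; [discriminate|].
  destruct e as [|m].
  { rewrite decode_0 in H. injection H as <-. apply (certifies_intro A 0 x 0 0 []); reflexivity. }
  rewrite decode_S in H. cbv zeta in H.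

  assert (K : forall N T, valid (restr A N) T = true -> justified (restr A N) T (S m) x y = true ->
    exists N T, certifies A (S m) x y N T) by (intros; eapply certifies_intro; eauto).
  unfold justified, ncase at 1 in K.
  destruct (fst' m) as [|[|[|[|[|[|[|[|t]]]]]]]] eqn:Em; cbn [Nat.eqb] in K.
  - injection H as <-. apply (K 0 []); [easy|apply Nat.eqb_refl].
  - injection H as <-. apply (K 0 []); [easy|apply Nat.eqb_refl].
  - injection H as <-. apply (K 0 []); [easy|apply Nat.eqb_refl].
  - injection H as <-. apply (K (S x) []); [easy|]. rewrite nth_error_restr.
    destruct (Nat.ltb_spec x (S x)); [|lia]. apply Nat.eqb_refl.
  - cbn [eval] in H. destruct (eval s A (decode (fst' (snd' m))) x) as [u|] eqn:E1; [|discriminate].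
    destruct (eval s A (decode (snd' (snd' m))) x) as [v|] eqn:E2; [|discriminate].
    injection H as <-.
    destruct (IH _ _ _ E1) as (N1 & T1 & I1 & V1). destruct (IH _ _ _ E2) as (N2 & T2 & I2 & V2).
    apply (K (N1 + N2) (T1 ++ T2)); [now apply valid_restr_app|].
    rewrite fst'_pair, snd'_pair, andb_true_iff, !listed_iff, !in_app_iff. auto.
  - cbn [eval] in H. destruct (eval s A (decode (snd' (snd' m))) x) as [u|] eqn:E1; [|discriminate].
    cbn [obind] in H.
    destruct (IH _ _ _ E1) as (N1 & T1 & I1 & V1). destruct (IH _ _ _ H) as (N2 & T2 & I2 & V2).
    apply (K (N1 + N2) (T1 ++ T2)); [now apply valid_restr_app|].
    apply existsb_exists. exists (snd' (snd' m), x, u). split; [apply in_app_iff; now left|].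
    rewrite andb_true_iff, listed_iff, in_app_iff, ebeq_refl. auto.
  - clear K.
    (* Earlier rounds of a recursion are runs of the same index [S m]; they need triples of their
       own, hence an induction on the counter. *)
    assert (G : forall n a y, eval_rec (eval s A) (decode (fst' (snd' m))) (decode (snd' (snd' m))) a n
        = Some y -> exists N T, certifies A (S m) (pair a n) y N T).
    { induction n as [|n IHn]; intros a z E; cbn [eval_rec] in E.
      - destruct (IH _ _ _ E) as (N1 & T1 & I1 & V1).
        apply (certifies_intro A (S m) (pair a 0) z N1 T1); [easy|].
        unfold justified, ncase at 1. rewrite Em, fst'_pair, snd'_pair. now apply listed_iff.
      - change ((fix loop (n : nat) : option nat :=
          match n with
          | 0 => eval s A (decode (fst' (snd' m))) a
          | S m0 => obind (loop m0) (fun h => eval s A (decode (snd' (snd' m))) (pair a (pair m0 h)))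
          end) n) with (eval_rec (eval s A) (decode (fst' (snd' m))) (decode (snd' (snd' m))) a n) in E.
        destruct (eval_rec _ _ _ a n) as [h|] eqn:E1; [|discriminate]. cbn [obind] in E.
        destruct (IHn _ _ E1) as (N1 & T1 & I1 & V1). destruct (IH _ _ _ E) as (N2 & T2 & I2 & V2).
        apply (certifies_intro A (S m) (pair a (S n)) z (N1 + N2) (T1 ++ T2)); [now apply valid_restr_app|].
        unfold justified, ncase at 1. rewrite Em, fst'_pair, snd'_pair. cbn [Nat.eqb ncase].
        apply existsb_exists. exists (S m, pair a n, h). split; [apply in_app_iff; now left|].
        rewrite andb_true_iff, listed_iff, in_app_iff, ebeq_refl. auto. }
    rewrite <- (pair_fst_snd x). apply G. exact H.
  - cbn [eval] in H. apply (eval_min_inv (eval s A) (decode (snd' m)) x y) in H as [H1 H2].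
    destruct (IH _ _ _ H1) as (N1 & T1 & I1 & V1).
    assert (G : forall n, n <= y -> exists N T, valid (restr A N) T = true /\
      forall j, j < n -> exists v, In (snd' m, pair x j, S v) T).
    { induction n as [|n IHn]; intros L; [exists 0, []; split; [easy|intros; lia]|].
      destruct IHn as (N2 & T2 & V2 & I2); [lia|].
      destruct (H2 n ltac:(lia)) as [v Hv].
      destruct (IH _ _ _ Hv) as (N3 & T3 & I3 & V3).
      exists (N2 + N3), (T2 ++ T3). split; [now apply valid_restr_app|].
      intros j Lj. destruct (Nat.eq_dec j n) as [->|].
      - exists v. apply in_app_iff. now right.
      - destruct (I2 j ltac:(lia)) as [w Hw]. exists w. apply in_app_iff. now left. }
    destruct (G y (le_n y)) as (N2 & T2 & V2 & I2).
    apply (K (N1 + N2) (T1 ++ T2)); [now apply valid_restr_app|].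
    apply andb_true_iff. split; [apply listed_iff, in_app_iff; now left|].
    apply forallb_forall. intros j Hj. apply in_seq in Hj.
    destruct (I2 j ltac:(lia)) as [v Hv]. apply existsb_exists.
    exists (snd' m, pair x j, S v). split; [apply in_app_iff; now right|].
    now rewrite ebeq_refl.
  - injection H as <-. now apply (K 0 []).
Qed.

Lemma Ev_complete A e x y : run A (decode e) x y ->
  exists N, forall s, N <= s -> Ev (restr A s) e x = Some y.
Proof.
  intros [f H]. destruct (certificate_exists A f e x y H) as (N & T & I & V).
  (* Long enough to contain the first [N] oracle bits and to have the code of [T] among the tables
     tried. *)
  exists (S (N + enc T)). intros s L. apply (facts_Ev A); [apply extends_restr|].
  apply in_flat_map. exists (enc T). rewrite in_seq, restr_length, table_of_enc.
  split; [lia|]. rewrite (valid_restr_le A N s T); [exact I|lia|exact V].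
Qed.

(** * Branching structure of finite sets of strings *)

Notation str := (list bool).

(** The first branching position. Comparing with the head suffices: two strings that differ at a
    position cannot both agree with the head there. *)
Definition dif (B : list str) : option nat :=
  find (fun i => existsb (fun r => negb (Bool.eqb (nth i r false) (nth i (hd [] B) false))) B)
    (seq 0 (length (hd [] B))).

(** A set without branching counts as both of its halves, so in a nonempty set of strings of equal
    length every address names a nonempty block. *)
Definition spl (B : list str) (b : bool) : list str :=
  ocase (dif B) B (fun p => filter (fun r => Bool.eqb (nth p r false) b) B).

Definition blk (u : str) (B : list str) : list str := fold_left spl u B.

Definition allstr (l : nat) : list str :=
  natrec [[]] (fun _ L => flat_map (fun u => [false :: u; true :: u]) L) l.

Definition ext (B : list str) : list str := flat_map (fun r => [r ++ [false]; r ++ [true]]) B.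

Definition len (n : nat) (B : list str) : Prop := forall r, In r B -> length r = n.

Definition seteq {X} (B B' : list X) : Prop := forall r, In r B <-> In r B'.

Lemma find_seq f n p : find f (seq 0 n) = Some p ->
  p < n /\ f p = true /\ forall i, i < p -> f i = false.
Proof.
  assert (G : forall n s, find f (seq s n) = Some p ->
    s <= p < s + n /\ f p = true /\ forall i, s <= i < p -> f i = false).
  { clear n. induction n as [|n IH]; intros s H; [discriminate|]. cbn in H. destruct (f s) eqn:E.
    - injection H as <-. split; [lia|]. split; [easy|]. intros; lia.
    - apply IH in H as (H1 & H2 & H3). split; [lia|]. split; [easy|]. intros i Li.
      destruct (Nat.eq_dec i s) as [->|]; [easy|]. apply H3. lia. }
  intros H. apply G in H as (H1 & H2 & H3). split; [lia|]. split; [easy|]. intros; apply H3; lia.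
Qed.

Lemma dif_Some n B p : len n B -> dif B = Some p ->
  p < n /\ (forall i r r', i < p -> In r B -> In r' B -> nth i r false = nth i r' false) /\
  exists r r', In r B /\ In r' B /\ nth p r false <> nth p r' false.
Proof.
  intros L H. apply find_seq in H as (H1 & H2 & H3).
  destruct B as [|r0 B]; [cbn in H1; lia|]. cbn [hd] in *. split; [now rewrite <- (L r0 (or_introl eq_refl))|].
  assert (K : forall i r, i < p -> In r (r0 :: B) -> nth i r false = nth i r0 false).
  { intros i r Li I. specialize (H3 i Li). destruct (Bool.eqb (nth i r false) (nth i r0 false)) eqn:E.
    - now apply eqb_prop.
    - enough (X : existsb (fun r => negb (Bool.eqb (nth i r false) (nth i r0 false))) (r0 :: B) = true)
        by congruence.
      apply existsb_exists. exists r. now rewrite E. }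
  split; [intros i r r' Li I I'; now rewrite (K i r), (K i r')|].
  apply existsb_exists in H2 as [r [I E]]. exists r, r0. split; [easy|]. split; [now left|].
  intros E'. rewrite E', eqb_reflx in E. discriminate.
Qed.

Lemma dif_None n B : len n B -> dif B = None -> forall r r', In r B -> In r' B -> r = r'.
Proof.
  intros L H. destruct B as [|r0 B]; [easy|].
  assert (K : forall r, In r (r0 :: B) -> r = r0).
  { intros r I. apply nth_ext with (d := false) (d' := false).
    - now rewrite (L r I), (L r0 (or_introl eq_refl)).
    - intros i Li. unfold dif in H. cbn [hd] in H.
      apply find_none with (x := i) in H.
      + destruct (Bool.eqb (nth i r false) (nth i r0 false)) eqn:E; [now apply eqb_prop|].
        enough (X : existsb (fun r => negb (Bool.eqb (nth i r false) (nth i r0 false))) (r0 :: B) = true)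
          by congruence.
        apply existsb_exists. exists r. now rewrite E.
      + apply in_seq. rewrite (L r I) in Li. rewrite (L r0 (or_introl eq_refl)). lia. }
  intros r r' I I'. now rewrite (K r I), (K r' I').
Qed.

Lemma dif_intro n B p : len n B ->
  (forall i r r', i < p -> In r B -> In r' B -> nth i r false = nth i r' false) ->
  (exists r r', In r B /\ In r' B /\ nth p r false <> nth p r' false) -> dif B = Some p.
Proof.
  intros L H1 (r & r' & I & I' & D). destruct (dif B) as [q|] eqn:E.
  - destruct (dif_Some n B q L E) as (_ & K & s & s' & J & J' & D'). f_equal.
    destruct (lt_eq_lt_dec p q) as [[Lt|Eq]|Lt]; [|easy|].
    + exfalso. apply D, K; auto.
    + exfalso. apply D', H1; auto.
  - exfalso. apply D. now rewrite (dif_None n B L E r r' I I').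
Qed.

Lemma spl_incl B b r : In r (spl B b) -> In r B.
Proof.
  unfold spl. destruct (dif B) as [p|]; cbn; [|easy]. intros I. now apply filter_In in I.
Qed.

Lemma in_spl B b p r : dif B = Some p -> (In r (spl B b) <-> In r B /\ nth p r false = b).
Proof.
  intros E. unfold spl. rewrite E. cbn. rewrite filter_In.
  split; intros [I H]; (split; [easy|]); [now apply eqb_prop|rewrite H; apply eqb_reflx].
Qed.

Lemma spl_None B b : dif B = None -> spl B b = B.
Proof. intros E. unfold spl. now rewrite E. Qed.

Lemma spl_cover B r : In r B -> exists b, In r (spl B b).
Proof.
  intros I. destruct (dif B) as [p|] eqn:E.
  - exists (nth p r false). now apply (in_spl _ _ _ _ E).
  - exists false. now rewrite spl_None.
Qed.

Lemma spl_len n B b : len n B -> len n (spl B b).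
Proof. intros L r I. apply L. now apply spl_incl in I. Qed.

Lemma spl_nonempty n B b : len n B -> (exists r, In r B) -> exists r, In r (spl B b).
Proof.
  intros L [r0 I0]. destruct (dif B) as [p|] eqn:E.
  - destruct (dif_Some n B p L E) as (_ & _ & r & r' & I & I' & D).
    destruct (bool_dec (nth p r false) b) as [Eb|Nb].
    + exists r. now apply (in_spl _ _ _ _ E).
    + exists r'. apply (in_spl _ _ _ _ E). split; [easy|].
      destruct b, (nth p r false), (nth p r' false); congruence.
  - exists r0. now rewrite spl_None.
Qed.

Lemma blk_incl u : forall B r, In r (blk u B) -> In r B.
Proof.
  induction u as [|b u IH]; intros B r I; [easy|]. apply IH in I. now apply spl_incl in I.
Qed.

Lemma blk_len n u B : len n B -> len n (blk u B).
Proof. intros L r I. apply L. now apply blk_incl in I. Qed.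

Lemma blk_nonempty n u : forall B, len n B -> (exists r, In r B) -> exists r, In r (blk u B).
Proof.
  induction u as [|b u IH]; intros B L H; [easy|].
  apply (IH (spl B b)); [now apply spl_len|]. eapply spl_nonempty; eauto.
Qed.

Lemma blk_cover l : forall B r, In r B -> exists u, length u = l /\ In r (blk u B).
Proof.
  induction l as [|l IH]; intros B r I; [now exists []|].
  destruct (spl_cover B r I) as [b Ib]. destruct (IH _ _ Ib) as [u [Lu Iu]].
  exists (b :: u). split; [cbn; now f_equal|easy].
Qed.

Lemma blk_app u v B : blk (u ++ v) B = blk v (blk u B).
Proof. apply fold_left_app. Qed.

Lemma blk_None u : forall B, dif B = None -> blk u B = B.
Proof.
  induction u as [|b u IH]; intros B E; [easy|]. cbn. rewrite spl_None by easy. now apply IH.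
Qed.

(** Where there is branching, a common string forces both addresses into the same half; where there
    is none, both halves are the whole set. *)
Lemma blk_meet u : forall v B r, length u = length v -> In r (blk u B) -> In r (blk v B) ->
  blk u B = blk v B.
Proof.
  induction u as [|b u IH]; intros [|c v] B r L Iu Iv; try easy. cbn in *.
  destruct (dif B) as [p|] eqn:E.
  - pose proof (blk_incl _ _ _ Iu) as Ju. pose proof (blk_incl _ _ _ Iv) as Jv.
    apply (in_spl _ _ _ _ E) in Ju as [_ <-], Jv as [_ <-].
    eapply IH; [lia|eassumption|easy].
  - rewrite !spl_None in * by easy. eapply IH; [lia|eassumption|easy].
Qed.

(** A subset meeting both halves has its first branching at the same position. *)
Lemma spl_sub n B B' : len n B -> incl B' B ->
  (forall b, exists r, In r B' /\ In r (spl B b)) ->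
  forall b r, In r (spl B' b) <-> In r B' /\ In r (spl B b).
Proof.
  intros L S H b r. assert (L' : len n B') by (intros s I; apply L, S, I).
  destruct (dif B) as [p|] eqn:E.
  - assert (E' : dif B' = Some p).
    { apply (dif_intro n); [easy| |].
      - intros. apply (dif_Some n B p L E); auto.
      - destruct (H true) as [r1 [I1 J1]], (H false) as [r2 [I2 J2]].
        apply (in_spl _ _ _ _ E) in J1 as [_ J1], J2 as [_ J2].
        exists r1, r2. rewrite J1, J2. easy. }
    rewrite (in_spl _ _ _ _ E), (in_spl _ _ _ _ E'). split; [|easy].
    intros [I N]. auto.
  - assert (E' : dif B' = None).
    { destruct (dif B') as [p|] eqn:E'; [|easy]. exfalso.
      destruct (dif_Some n B' p L' E') as (_ & _ & s & s' & I & I' & D).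
      apply D. now rewrite (dif_None n B L E s s' (S _ I) (S _ I')). }
    rewrite !spl_None by easy. split; [auto|easy].
Qed.

(* Meeting every block of level [l] leaves the first [l] levels of branching unchanged. *)
Definition keeps (l : nat) (B' B : list str) : Prop :=
  incl B' B /\ forall u, length u = l -> exists r, In r B' /\ In r (blk u B).

Lemma keeps_le l l' B' B : l' <= l -> keeps l B' B -> keeps l' B' B.
Proof.
  intros L [S H]. split; [easy|]. intros u Lu.
  destruct (H (u ++ repeat false (l - l'))) as [r [I J]].
  { rewrite length_app, repeat_length. lia. }
  exists r. split; [easy|]. rewrite blk_app in J. now apply blk_incl in J.
Qed.

(** Makes blocks comparable across stages: pruning that still meets every block of this level does
    not change the address of a surviving string. *)
Lemma blk_keeps n u : forall B B', len n B -> keeps (length u) B' B ->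
  forall r, In r (blk u B') <-> In r B' /\ In r (blk u B).
Proof.
  induction u as [|b u IH]; intros B B' L K r.
  - cbn. destruct K as [S _]. split; [auto|easy].
  - assert (Sp : forall b r, In r (spl B' b) <-> In r B' /\ In r (spl B b)).
    { destruct K as [S H]. apply (spl_sub n); [easy|easy|]. intros c.
      destruct (H (c :: repeat false (length u))) as [s [I J]].
      { cbn. now rewrite repeat_length. }
      exists s. split; [easy|]. exact (blk_incl _ (spl B c) _ J). }
    cbn [blk fold_left]. change (In r (blk u (spl B' b)) <-> In r B' /\ In r (blk u (spl B b))).
    rewrite (IH (spl B b) (spl B' b)).
    + rewrite Sp. split; [easy|]. intros [I J]. pose proof (blk_incl _ _ _ J). auto.
    + now apply spl_len.
    + destruct K as [S H]. split.
      * intros s I. now apply Sp in I.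
      * intros v Lv. destruct (H (b :: v)) as [s [I J]]; [cbn; now f_equal|].
        exists s. split; [|easy]. apply Sp. split; [easy|]. exact (blk_incl _ (spl B b) _ J).
Qed.

Lemma keeps_trans n l B2 B1 B : len n B -> keeps l B2 B1 -> keeps l B1 B -> keeps l B2 B.
Proof.
  intros L [S2 H2] K1. pose proof K1 as [S1 H1]. split; [eapply incl_tran; eauto|].
  intros u Lu. destruct (H2 u Lu) as [r [I J]]. exists r. split; [easy|].
  subst l. now apply (blk_keeps n u B B1 L K1) in J.
Qed.

Lemma keeps_seteq n l B B' : len n B -> (exists r, In r B) -> seteq B' B -> keeps l B' B.
Proof.
  intros L H E. split; [intros r I; now apply E|]. intros u _.
  destruct (blk_nonempty n u B L H) as [r I]. exists r. split; [|easy]. apply E.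
  now apply blk_incl in I.
Qed.

Lemma blk_seteq n u B B' : len n B -> (exists r, In r B) -> seteq B' B ->
  seteq (blk u B') (blk u B).
Proof.
  intros L H E r. rewrite (blk_keeps n u B B' L); [|eapply keeps_seteq; eauto].
  split; [easy|]. intros I. split; [apply E; now apply blk_incl in I|easy].
Qed.

Lemma in_allstr l u : In u (allstr l) <-> length u = l.
Proof.
  revert u. induction l as [|l IH]; intros u.
  - cbn. destruct u; cbn; split; try easy; [now left|intros [|[]]; easy].
  - cbn [allstr natrec]. change (natrec _ _ l) with (allstr l). rewrite in_flat_map. split.
    + intros [v [I [<-|[<-|[]]]]]; cbn; f_equal; now apply IH.
    + destruct u as [|b u]; [easy|]. cbn. intros [= L]. exists u. split; [now apply IH|].
      destruct b; cbn; auto.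
Qed.

Lemma in_ext r B : In r (ext B) <-> exists s b, In s B /\ r = s ++ [b].
Proof.
  unfold ext. rewrite in_flat_map. split.
  - intros [s [I [<-|[<-|[]]]]]; eauto.
  - intros (s & b & I & ->). exists s. split; [easy|]. destruct b; cbn; auto.
Qed.

Lemma ext_len n B : len n B -> len (S n) (ext B).
Proof.
  intros L r I. apply in_ext in I as (s & b & I & ->). rewrite length_app, (L s I). cbn. lia.
Qed.

Lemma ext_nonempty B : (exists r, In r B) -> exists r, In r (ext B).
Proof. intros [r I]. exists (r ++ [false]). apply in_ext. eauto. Qed.

(** The branching position lies inside the old strings, so the appended bits are not consulted. *)
Lemma spl_ext n B b : len n B -> dif B <> None -> spl (ext B) b = ext (spl B b).
Proof.
  intros L D. destruct (dif B) as [p|] eqn:E; [|easy]. clear D.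
  destruct (dif_Some n B p L E) as (Lp & H1 & r & r' & I & I' & D).
  assert (N : forall s c i, In s B -> i <= p -> nth i (s ++ [c]) false = nth i s false).
  { intros s c i J Li. apply app_nth1. rewrite (L s J). lia. }
  assert (E' : dif (ext B) = Some p).
  { apply (dif_intro (S n)); [now apply ext_len| |].
    - intros i s s' Li J J'. apply in_ext in J as (t & c & J & ->), J' as (t' & c' & J' & ->).
      rewrite !N by (easy || lia). now apply H1.
    - exists (r ++ [false]), (r' ++ [false]). rewrite !N by (easy || lia).
      split; [apply in_ext; eauto|]. split; [apply in_ext; eauto|easy]. }
  unfold spl. rewrite E, E'. cbn [ocase]. clear - N. revert N.
  induction B as [|s B IH]; intros N; [easy|]. cbn [ext flat_map app filter].
  rewrite !(N s) by (try lia; now left).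
  change (flat_map _ B) with (ext B). rewrite IH by (intros; apply N; [now right|easy]).
  now destruct (Bool.eqb (nth p s false) b).
Qed.

(** When branching stops along [u], the block in [B] is the whole current set and still contains the
    parent. The converse can fail, because the appended bits create new branching. *)
Lemma blk_ext n u : forall B r, len n B -> In r (blk u (ext B)) ->
  exists s b, In s (blk u B) /\ r = s ++ [b].
Proof.
  induction u as [|c u IH]; intros B r L I; [now apply in_ext|].
  destruct (dif B) as [p|] eqn:E.
  - cbn in *. rewrite (spl_ext n) in I by (easy || congruence). apply IH; [now apply spl_len|easy].
  - rewrite blk_None by easy. apply blk_incl in I. now apply in_ext.
Qed.

(** The first [d] branchings really exist, so distinct addresses of length [d] name disjoint
    blocks. *)
Definition full (d : nat) (B : list str) : Prop :=
  forall u, length u < d -> dif (blk u B) <> None.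

Lemma blk_ext_full n u : forall B, len n B -> full (length u) B -> blk u (ext B) = ext (blk u B).
Proof.
  induction u as [|c u IH]; intros B L F; [easy|].
  cbn. rewrite (spl_ext n); [|easy|apply (F []); cbn; lia].
  apply IH; [now apply spl_len|]. intros v Lv. apply (F (c :: v)). cbn. lia.
Qed.

(** A block at depth [d] branches after the extension at the latest in its appended bit, which gains
    one level. *)
Lemma full_ext n d B : len n B -> (exists r, In r B) -> full d B -> full (S d) (ext B).
Proof.
  intros L H F u Lu E.
  rewrite (blk_ext_full n) in E; [|easy|intros v Lv; apply F; lia].
  destruct (blk_nonempty n u B L H) as [r I].
  assert (X : r ++ [false] = r ++ [true]).
  { apply (dif_None (S n) _ (ext_len n _ (blk_len n u B L)) E); apply in_ext; eauto. }
  apply app_inj_tail in X as [_ X]. discriminate.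
Qed.

Lemma full_keeps n d B' B : len n B -> keeps d B' B -> full d B -> full d B'.
Proof.
  intros L K F u Lu E.
  destruct (dif (blk u B)) as [p|] eqn:Ep; [|now apply (F u Lu)].
  assert (L' : len n B') by (intros r I; now apply L, K).
  assert (G : forall b, exists r, In r (blk u B') /\ nth p r false = b).
  { intros b. pose proof (keeps_le d (S (length u)) B' B Lu K) as [_ H].
    destruct (H (u ++ [b])) as [r [I J]]; [rewrite length_app; cbn; lia|].
    rewrite blk_app in J. cbn in J. apply (in_spl _ _ _ _ Ep) in J as [J Eb].
    exists r. split; [|easy]. apply (blk_keeps n u B B' L); [|easy].
    eapply keeps_le; [|apply K]. lia. }
  destruct (G true) as [r [I Er]], (G false) as [r' [I' Er']].
  rewrite (dif_None n _ (blk_len n u B' L') E r r' I I') in Er. congruence.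
Qed.

Lemma full_blk_inj B u v r : full (length u) B -> length u = length v ->
  In r (blk u B) -> In r (blk v B) -> u = v.
Proof.
  revert v B. induction u as [|b u IH]; intros [|c v] B F L I J; try easy.
  destruct (dif B) as [p|] eqn:E; [|exfalso; apply (F []); [cbn; lia|easy]].
  cbn in I, J. pose proof (blk_incl _ _ _ I) as I'. pose proof (blk_incl _ _ _ J) as J'.
  apply (in_spl _ _ _ _ E) in I' as [_ I'], J' as [_ J']. rewrite <- I', <- J' in *. clear b c I' J'.
  f_equal. apply (IH v (spl B (nth p r false))); auto. intros w Lw. apply (F (nth p r false :: w)). cbn. lia.
Qed.

(** * Uniformization of blocks *)

Definition uni (g : str -> list nat) (C : list str) : bool :=
  forallb (fun r => ebeq (g r) (g (hd [] C))) C.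

Definition best (g : str -> list nat) (C : list str) : str :=
  fold_left (fun a r => if S (length (g a)) <=? length (g r) then r else a) C (hd [] C).

Definition unify (g : str -> list nat) (C : list str) : list str :=
  if uni g C then C else [best g C].

Definition act (g : str -> list nat) (l : nat) (B : list str) : list str :=
  flat_map (fun u => unify g (blk u B)) (allstr l).

Definition uniform (g : str -> list nat) (C : list str) : Prop :=
  forall r r', In r C -> In r' C -> g r = g r'.

Lemma uni_true g C : uni g C = true -> uniform g C.
Proof.
  unfold uni. rewrite forallb_forall. intros H r r' I I'.
  rewrite (ebeq_eq _ _ (H r I)), (ebeq_eq _ _ (H r' I')). reflexivity.
Qed.

Lemma hd_in {X} (d : X) C : (exists r, In r C) -> In (hd d C) C.
Proof. destruct C; [now intros []|]. now left. Qed.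

Lemma uni_intro g C : uniform g C -> uni g C = true.
Proof.
  intros H. apply forallb_forall. intros r I. rewrite (H r (hd [] C)); [apply ebeq_refl|easy|].
  apply hd_in. eauto.
Qed.

Lemma best_in g C : (exists r, In r C) -> In (best g C) C.
Proof.
  intros H. apply (hd_in []) in H. unfold best.
  enough (G : forall C' a, incl C' C -> In a C -> In (fold_left (fun a r =>
    if S (length (g a)) <=? length (g r) then r else a) C' a) C)
    by (apply G; [apply incl_refl|easy]).
  induction C' as [|r C' IH]; intros a Hi I; [easy|]. cbn [fold_left]. apply IH.
  - intros x Ix. apply Hi. now right.
  - destruct (S (length (g a)) <=? length (g r)); [apply Hi; now left|exact I].
Qed.

Lemma best_max g C r : In r C -> length (g r) <= length (g (best g C)).
Proof.
  unfold best. generalize (hd [] C) as a.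
  set (f := fun a r => if S (length (g a)) <=? length (g r) then r else a).
  assert (M : forall C a, length (g a) <= length (g (fold_left f C a))).
  { induction C0 as [|x C0 IH]; intros a; [easy|]. cbn [fold_left].
    eapply Nat.le_trans; [|apply IH]. unfold f. destruct (Nat.leb_spec (S (length (g a))) (length (g x))); lia. }
  induction C as [|x C IH]; intros a; [easy|]. intros [->|I]; [|now apply IH].
  cbn [fold_left]. eapply Nat.le_trans; [|apply M]. unfold f.
  destruct (Nat.leb_spec (S (length (g a))) (length (g r))); lia.
Qed.

Lemma unify_incl g C : incl (unify g C) C.
Proof.
  unfold unify. destruct (uni g C) eqn:E; [apply incl_refl|]. intros r [<-|[]].
  apply best_in. destruct C as [|r C]; [discriminate|]. exists r. now left.
Qed.

Lemma unify_nonempty g C : (exists r, In r C) -> exists r, In r (unify g C).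
Proof. unfold unify. destruct (uni g C); [easy|]. intros _. exists (best g C). now left. Qed.

Lemma unify_uniform g C : uniform g (unify g C).
Proof.
  unfold unify. destruct (uni g C) eqn:E; [now apply uni_true|]. now intros r r' [<-|[]] [<-|[]].
Qed.

Lemma in_act g l B r : In r (act g l B) <-> exists u, length u = l /\ In r (unify g (blk u B)).
Proof.
  unfold act. rewrite in_flat_map. split; intros [u [I J]]; exists u; now rewrite in_allstr in *.
Qed.

Lemma act_keeps n g l B : len n B -> (exists r, In r B) -> keeps l (act g l B) B.
Proof.
  intros L H. split.
  - intros r I. apply in_act in I as [u [_ I]]. apply unify_incl in I. now apply blk_incl in I.
  - intros u Lu. destruct (unify_nonempty g (blk u B)) as [r I]; [eapply blk_nonempty; eauto|].
    exists r. split; [apply in_act; eauto|]. now apply unify_incl in I.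
Qed.

Lemma blk_act n g u B : len n B -> (exists r, In r B) ->
  seteq (blk u (act g (length u) B)) (unify g (blk u B)).
Proof.
  intros L H r. rewrite (blk_keeps n u B); [|easy|eapply act_keeps; eauto]. split.
  - intros [I J]. apply in_act in I as [v [Lv I]].
    rewrite (blk_meet u v B r); [easy|easy|easy|]. now apply unify_incl in I.
  - intros I. split; [apply in_act; eauto|]. now apply unify_incl in I.
Qed.

(** Equality holds only as sets: [act] lists block after block and repeats a block that has several
    addresses. *)
Lemma act_trivial g l B : (forall u, length u = l -> uniform g (blk u B)) -> seteq (act g l B) B.
Proof.
  intros H r. rewrite in_act. split.
  - intros [u [_ I]]. apply unify_incl in I. now apply blk_incl in I.
  - intros I. destruct (blk_cover l B r I) as [u [Lu J]]. exists u. split; [easy|].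
    unfold unify. now rewrite uni_intro by auto.
Qed.

Definition acts (st : nat -> str -> list nat) (cl : list (nat * nat)) (B : list str) : list str :=
  fold_left (fun B c => act (st (fst c)) (snd c) B) cl B.

Lemma keeps_refl n l B : len n B -> (exists r, In r B) -> keeps l B B.
Proof. intros L H. apply (keeps_seteq n); easy. Qed.

Lemma keeps_nonempty l B B' : keeps l B' B -> exists r, In r B'.
Proof. intros [_ H]. destruct (H (repeat false l)) as [r [I _]]; [apply repeat_length|eauto]. Qed.

Lemma keeps_len n l B B' : len n B -> keeps l B' B -> len n B'.
Proof. intros L [H _] r I. apply L, H, I. Qed.

Lemma acts_keeps st n l cl : forall B, len n B -> (exists r, In r B) ->
  (forall c, In c cl -> l <= snd c) -> keeps l (acts st cl B) B.
Proof.
  induction cl as [|c cl IH]; intros B L H Hl; [now apply (keeps_refl n)|].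
  pose proof (act_keeps n (st (fst c)) (snd c) B L H) as K.
  apply (keeps_trans n) with (B1 := act (st (fst c)) (snd c) B); [easy| |].
  - apply IH; [eapply keeps_len; eauto|eapply keeps_nonempty; eauto|].
    intros d Id. apply Hl. now right.
  - eapply keeps_le; [|apply K]. apply Hl. now left.
Qed.

(** * Potentials and the effect of one stage *)

(** With [D] a bound on the lengths of histories, this is the largest number of values that a string
    of the block may still record. *)
Definition mx (g : str -> list nat) (D : nat) (C : list str) : nat :=
  list_max (map (fun r => D - length (g r)) C).

Fixpoint pot (g : str -> list nat) (D l : nat) (B : list str) : nat :=
  match l with
  | 0 => mx g D B
  | S l' => pot g D l' (spl B false) + pot g D l' (spl B true)
  end.

Lemma mx_ge g D C r : In r C -> D - length (g r) <= mx g D C.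
Proof.
  intros I. unfold mx. pose proof (proj1 (list_max_le (map (fun r => D - length (g r)) C) _) (le_n _)) as H.
  rewrite Forall_forall in H. apply H. now apply (in_map (fun r => D - length (g r))).
Qed.

Lemma mx_le g D C m : (forall r, In r C -> D - length (g r) <= m) -> mx g D C <= m.
Proof.
  intros H. apply list_max_le, Forall_forall. intros x I. apply in_map_iff in I as [r [<- I]]. auto.
Qed.

Lemma pot_bound g D l : forall B, pot g D l B <= 2 ^ l * D.
Proof.
  induction l as [|l IH]; intros B; cbn [pot].
  - apply mx_le. intros. cbn. lia.
  - pose proof (IH (spl B false)). pose proof (IH (spl B true)). cbn [Nat.pow]. nia.
Qed.

(** A maximum over a block is at most the sum of the maxima over its halves; hence lowering a claim
    does not raise its potential. *)
Lemma pot_S_le g D l : forall B, pot g D l B <= pot g D (S l) B.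
Proof.
  induction l as [|l IH]; intros B.
  - cbn [pot]. apply mx_le. intros r I. destruct (spl_cover B r I) as [b Ib].
    apply (mx_ge g D) in Ib. destruct b; lia.
  - pose proof (IH (spl B false)). pose proof (IH (spl B true)).
    change (pot g D (S (S l)) B) with (pot g D (S l) (spl B false) + pot g D (S l) (spl B true)).
    cbn [pot] in *. lia.
Qed.

Lemma pot_level_le g D l l' B : l <= l' -> pot g D l B <= pot g D l' B.
Proof. induction 1; [easy|]. pose proof (pot_S_le g D m B). lia. Qed.

Lemma pot_le g D l : forall B B',
  (forall u, length u = l -> mx g D (blk u B') <= mx g D (blk u B)) ->
  pot g D l B' <= pot g D l B /\
  (pot g D l B' = pot g D l B -> forall u, length u = l -> mx g D (blk u B') = mx g D (blk u B)).
Proof.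
  induction l as [|l IH]; intros B B' H.
  - split; [apply (H [] eq_refl)|]. intros E [|b u] Lu; [exact E|easy].
  - destruct (IH (spl B false) (spl B' false)) as [L0 E0];
      [intros u Lu; apply (H (false :: u)); cbn; now f_equal|].
    destruct (IH (spl B true) (spl B' true)) as [L1 E1];
      [intros u Lu; apply (H (true :: u)); cbn; now f_equal|].
    cbn [pot]. split; [lia|]. intros E [|[] u] Lu; [easy| |]; injection Lu as Lu.
    + apply E1; [lia|easy].
    + apply E0; [lia|easy].
Qed.

(** The level is added so that a lowering counts as a decrease even if the potential stays the
    same. *)
Definition weight (st : nat -> str -> list nat) (D : nat) (B : list str) (c : nat * nat) : nat :=
  snd c + pot (st (fst c)) D (snd c) B.

(** The head of a history is its latest value, and one leaf speaks for its block because the blocks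
    of a claim are kept uniform. *)
Definition trace (st : nat -> str -> list nat) (B : list str) (c : nat * nat) : list nat :=
  flat_map (fun u => lcase (st (fst c) (hd [] (blk u B))) [] (fun v _ => [v])) (allstr (snd c)).

Inductive lex : list nat -> list nat -> Prop :=
| lex_here x y u v : x < y -> length u = length v -> lex (x :: u) (y :: v)
| lex_next x u v : lex u v -> lex (x :: u) (x :: v).

Definition le_level (c d : nat * nat) : Prop := snd c <= snd d.

Definition lowers (a a' : nat * nat) : Prop := fst a = fst a' /\ snd a' <= snd a.

(** Here [c'] are the claims [c] of the previous stage, possibly lowered, and [post] the remaining
    ones. In the induction [E] agrees with the extended leaves as long as no earlier claim has
    changed anything. The first claim whose level or histories change loses weight, since the claims
    after it keep its blocks; if there is none, the stage has left [c] and its traces alone. *)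
Lemma acts_lex st D n P post : len n P -> (exists r, In r P) ->
  (forall q r b, exists v, st q (r ++ [b]) = v ++ st q r) ->
  forall c c' E, Forall2 lowers c c' ->
  StronglySorted le_level (c' ++ post) -> seteq E (ext P) ->
  (forall a u, In a c -> length u = snd a -> uniform (st (fst a)) (blk u P)) ->
  (forall a r, In a c -> length (st (fst a) r) <= D) ->
  let P' := acts st (c' ++ post) E in
  lex (map (weight st D P') c') (map (weight st D P) c) \/
  (c' = c /\ map (weight st D P') c' = map (weight st D P) c /\
   map (trace st P') c' = map (trace st P) c /\ seteq (acts st c' E) (ext P)).
Proof.
  intros LP HP Hst. induction c as [|a c IH]; intros c' E F Hs HE HU HD P'.
  { inversion F; subst. right. auto. }
  inversion F as [|? a' ? c1 Ha F' E1 E2]; subst. clear F.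
  set (g := st (fst a)) in *.
  assert (LE : len (S n) E) by (intros r I; apply HE in I; revert r I; now apply ext_len).
  assert (HEne : exists r, In r E).
  { destruct (ext_nonempty P HP) as [r I]. exists r. now apply HE. }
  destruct Ha as [Eq Le].
  set (E1 := act (st (fst a')) (snd a') E) in *.
  assert (KE1 : keeps (snd a') E1 E) by (now apply (act_keeps (S n))).
  assert (LE1 : len (S n) E1) by (eapply keeps_len; eauto).
  (* Sortedness enters here: all later claims have at least this level, so the final leaves still
     meet every block of this claim. *)
  assert (K1 : keeps (snd a') P' E1).
  { change P' with (acts st (c1 ++ post) E1). apply (acts_keeps st (S n)); [easy|eapply keeps_nonempty; eauto|].
    intros d Id. cbn in Hs. apply StronglySorted_inv in Hs as [_ Hs].
    rewrite Forall_forall in Hs. now apply Hs. }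
  assert (K : keeps (snd a') P' E) by (eapply (keeps_trans (S n)); eauto).
  assert (Up : forall u, length u <= snd a' -> forall r, In r (blk u P') ->
    exists s b, In s (blk u P) /\ r = s ++ [b]).
  { intros u Lu r I. apply (blk_keeps (S n) u E) in I as [_ I]; [|easy|eapply keeps_le; eauto].
    apply (blk_ext n); [easy|]. apply (blk_seteq (S n) u (ext P) E); [now apply ext_len|now apply ext_nonempty|easy|easy]. }
  assert (Mx : forall u, length u = snd a' -> mx g D (blk u P') <= mx g D (blk u P)).
  { intros u Lu. apply mx_le. intros r I. apply Up in I as (s & b & I & ->); [|lia].
    pose proof (mx_ge g D _ _ I). destruct (Hst (fst a) s b) as [v Ev]. fold g in Ev.
    rewrite Ev, length_app. lia. }
  destruct (pot_le g D (snd a') P P' Mx) as [PL PE].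
  pose proof (pot_level_le g D _ _ P Le) as PL'.
  assert (LF : length c1 = length c) by (symmetry; eapply Forall2_length; eauto).
  assert (Wa : weight st D P' a' = snd a' + pot g D (snd a') P').
  { unfold weight, g. now rewrite Eq. }
  assert (Wb : weight st D P a = snd a + pot g D (snd a) P) by easy.
  destruct (Nat.lt_ge_cases (weight st D P' a') (weight st D P a)) as [Lt|Ge].
  { left. cbn [map]. constructor; [easy|]. now rewrite !length_map. }
  (* Neither level nor potential can increase, so a weight that does not drop leaves both
     unchanged. *)
  assert (El : snd a' = snd a) by lia.
  assert (a' = a) by (destruct a, a'; cbn in *; congruence). subst a'. clear Eq Le El PL' Wa Wb.
  fold g in E1.
  assert (Mx' : forall u, length u = snd a -> mx g D (blk u P') = mx g D (blk u P)).
  { apply PE. unfold weight in Ge. fold g in Ge. lia. }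
  assert (Same : forall u r s, length u = snd a -> In r (blk u E) -> In s (blk u P) -> g r = g s).
  { intros u r s Lu I Is.
    assert (X : exists s' b, In s' (blk u P) /\ r = s' ++ [b]).
    { apply (blk_ext n); [easy|]. apply (blk_seteq (S n) u (ext P) E); [now apply ext_len|now apply ext_nonempty|easy|easy]. }
    destruct X as (s' & b & Is' & ->).
    assert (Hss : g s = g s') by (apply (HU a u (or_introl eq_refl) Lu s s' Is Is')). rewrite Hss.
    destruct (Hst (fst a) s' b) as [v Ev]. fold g in Ev. destruct v as [|x v]; [easy|exfalso].
    (* Otherwise every leaf of this block of [P'] has a longer history than those of [P]. *)
    assert (Lg : forall t, In t (blk u P') -> length (g s') < length (g t)).
    { intros t It. apply (blk_keeps (S n) u E1) in It as [_ It]; [|easy|now rewrite Lu].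
      subst E1. rewrite <- Lu in It. apply (blk_act (S n)) in It; [|easy|easy].
      assert (Lb : length (g s') < length (g (s' ++ [b]))) by (rewrite Ev, length_app; cbn; lia).
      unfold unify in It. destruct (uni g (blk u E)) eqn:Eu.
      - now rewrite (uni_true g _ Eu t (s' ++ [b]) It I).
      - destruct It as [<-|[]]. pose proof (best_max g _ _ I). lia. }
    assert (LP' : len (S n) P') by (eapply keeps_len; eauto).
    destruct (blk_nonempty (S n) u P' LP' (keeps_nonempty _ _ _ K)) as [t It].
    (* Needed because subtraction is truncated: beyond [D] a longer history would not lower the
       maximum. *)
    pose proof (HD a t (or_introl eq_refl)) as Dt. fold g in Dt.
    pose proof (Lg t It). pose proof (mx_ge g D _ _ Is').
    enough (mx g D (blk u P') < mx g D (blk u P)) by (rewrite (Mx' u Lu) in *; lia).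
    enough (mx g D (blk u P') <= D - S (length (g s'))) by lia.
    apply mx_le. intros t' It'. pose proof (Lg t' It'). lia. }
  assert (UE : forall u, length u = snd a -> uniform g (blk u E)).
  { intros u Lu r r' I I'. destruct (blk_nonempty n u P LP HP) as [s Is].
    now rewrite (Same u r s Lu I Is), (Same u r' s Lu I' Is). }
  assert (Te : trace st P' a = trace st P a).
  { unfold trace. fold g. rewrite !flat_map_concat_map. f_equal. apply map_ext_in. intros u Iu. apply in_allstr in Iu.
    rewrite (Same u (hd [] (blk u P')) (hd [] (blk u P))); [easy|easy| |].
    - assert (LP' : len (S n) P') by (eapply keeps_len; eauto).
      pose proof (blk_nonempty (S n) u P' LP' (keeps_nonempty _ _ _ K)) as Ne.
      apply (hd_in []) in Ne. apply (blk_keeps (S n) u E) in Ne; [easy|easy|now rewrite Iu].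
    - apply hd_in. eapply blk_nonempty; eauto. }
  destruct (IH c1 E1) as [Lx|(Ec & Ew & Et & Es)].
  - exact F'.
  - now apply StronglySorted_inv in Hs.
  - intros r. rewrite <- (HE r). apply act_trivial. exact UE.
  - intros. apply HU; [now right|easy].
  - intros. apply HD. now right.
  - left. cbn [map]. replace (weight st D P' a) with (weight st D P a).
    + now constructor.
    + unfold weight. fold g. unfold weight in Ge. fold g in Ge. lia.
  - right. change (acts st (c1 ++ post) E1) with P' in *. split; [now f_equal|].
    split; [cbn [map]; f_equal; [|exact Ew]|].
    + unfold weight. fold g. unfold weight in Ge. fold g in Ge. lia.
    + split; [cbn [map]; now f_equal|exact Es].
Qed.

Fixpoint digits (b : nat) (w : list nat) : nat :=
  match w with [] => 0 | x :: t => x * b ^ length t + digits b t end.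

Lemma digits_bound b w : (forall x, In x w -> x < b) -> digits b w < b ^ length w.
Proof.
  induction w as [|x w IH]; intros H; cbn; [lia|].
  assert (digits b w < b ^ length w) by (apply IH; intros; apply H; now right).
  assert (x < b) by (apply H; now left). nia.
Qed.

(** Only the smaller word [w'] needs digits below the base: one unit in the first differing place
    outweighs its whole remainder. *)
Lemma digits_lex b w w' : lex w' w -> (forall x, In x w' -> x < b) -> digits b w' < digits b w.
Proof.
  induction 1 as [x y u v Lt L|x u v Lx IH]; intros H.
  - cbn. rewrite L. assert (digits b u < b ^ length u) by (apply digits_bound; intros; apply H; now right).
    rewrite L in *. pose proof (Nat.mul_le_mono_r (S x) y (b ^ length v) Lt). cbn in *. lia.
  - cbn. assert (L : length u = length v).
    { clear - Lx. induction Lx; cbn; congruence. }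
    rewrite L. assert (digits b u < digits b v) by (apply IH; intros; apply H; now right). lia.
Qed.

Lemma trace_card st B c : length (trace st B c) <= 2 ^ snd c.
Proof.
  assert (L : forall l, length (allstr l) = 2 ^ l).
  { induction l as [|l IH]; [easy|]. cbn [allstr natrec Nat.pow].
    change (natrec _ _ l) with (allstr l). rewrite <- IH. clear IH.
    induction (allstr l) as [|u t IHt]; [easy|]. cbn in *. lia. }
  rewrite <- L. unfold trace. induction (allstr (snd c)) as [|u t IH]; [easy|].
  cbn [flat_map length]. rewrite length_app.
  destruct (st (fst c) (hd [] (blk u B))); cbn in *; lia.
Qed.

Lemma in_trace st n B c r v t : len n B -> (forall u, length u = snd c -> uniform (st (fst c)) (blk u B)) ->
  In r B -> st (fst c) r = v :: t -> In v (trace st B c).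
Proof.
  intros L U I E. destruct (blk_cover (snd c) B r I) as [u [Lu J]].
  apply in_flat_map. exists u. rewrite in_allstr. split; [easy|].
  rewrite (U u Lu (hd [] (blk u B)) r); [|apply hd_in; eauto|easy]. rewrite E. now left.
Qed.

(** * The construction *)

(** Bound functions are run with [no_oracle], so they are approximated along its initial
    segments. *)
Definition zeros (n : nat) : str := restr no_oracle n.

(* The successive distinct values of the functional with index [g] at argument [n] along [r],
   latest first and at most [b + 1] of them; the flag records that no computation has diverged. *)
Definition history_step (g n b : nat) (r : str) (t : nat) (s : bool * list nat) : bool * list nat :=
  if fst s then
    ocase (Ev r g (pair n t)) (false, snd s) (fun v =>
      (true, lcase (snd s) [v] (fun w _ =>
        if (v =? w) || (S b <=? length (snd s)) then snd s else v :: snd s)))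
  else s.

Definition history (g n b : nat) (r : str) (N : nat) : bool * list nat :=
  natrec (true, []) (history_step g n b r) N.

(* A requirement [pair n (pair g b)] has level [n] and asks to trace the value at [n] of the limit
   of the functional with index [g], whose number of changes is bounded by the function with
   index [b]. *)
Definition bound_at (s q : nat) : option nat := Ev (zeros s) (snd' (snd' q)) (fst' q).

Definition st (q : nat) (r : str) : list nat :=
  ocase (bound_at (length r) q) []
    (fun b => snd (history (fst' (snd' q)) (fst' q) b r (length r))).

(** The first conjunct leaves finitely many requirements of each level; the second makes the change
    bound of a claim known when it arrives. *)
Definition ready (q s : nat) : bool :=
  (snd' q <=? fst' q) && ocase (bound_at s q) false (fun _ => true).

Definition claimed (q : nat) (cl : list (nat * nat)) : bool := existsb (fun c => fst c =? q) cl.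

(** Stage [s] attends to the requirement [fst' s], so every requirement comes up at arbitrarily late
    stages. *)
Definition update (s : nat) (cl : list (nat * nat)) : list (nat * nat) :=
  if ready (fst' s) s && negb (claimed (fst' s) cl) then
    map (fun c => (fst c, Nat.min (snd c) (fst' (fst' s)))) cl ++ [(fst' s, fst' (fst' s))]
  else cl.

(** A newly arrived claim acts in the same stage, so at the end of every stage the blocks of all
    claims are uniform. *)
Definition stage (n : nat) : list (nat * nat) * list str :=
  natrec ([], [[]])
    (fun s p => (update s (fst p), acts st (update s (fst p)) (ext (snd p)))) n.

Notation claims s := (fst (stage s)).
Notation leaves s := (snd (stage s)).

(** * Computability of the construction *)

Lemma comp_zeros : Comp (fun _ n => zeros n).
Proof. unfold zeros, restr, no_oracle. comp. Qed.
#[global] Hint Resolve comp_zeros : comp_lib.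

Lemma comp_bound_at : Comp (fun _ (p : nat * nat) => bound_at (fst p) (snd p)).
Proof. unfold bound_at. comp. Qed.
#[global] Hint Resolve comp_bound_at : comp_lib.

Lemma comp_history :
  Comp (fun _ (p : nat * (nat * (nat * (str * nat)))) =>
    history (fst p) (fst (snd p)) (fst (snd (snd p))) (fst (snd (snd (snd p)))) (snd (snd (snd (snd p))))).
Proof. unfold history, history_step. comp. Qed.

Lemma comp_st : Comp (fun _ (p : nat * str) => st (fst p) (snd p)).
Proof.
  unfold st. comp.
  refine (comp_subst _ (fun _ p => (fst' (snd' (fst (fst p))), (fst' (fst (fst p)),
    (snd p, (snd (fst p), length (snd (fst p))))))) comp_history _). comp.
Qed.
#[global] Hint Resolve comp_st : comp_lib.

Lemma comp_claimed : Comp (fun _ (p : nat * list (nat * nat)) => claimed (fst p) (snd p)).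
Proof. unfold claimed. comp. Qed.
#[global] Hint Resolve comp_claimed : comp_lib.

Lemma comp_update : Comp (fun _ (p : nat * list (nat * nat)) => update (fst p) (snd p)).
Proof. unfold update, ready. comp. Qed.
#[global] Hint Resolve comp_update : comp_lib.

Lemma comp_dif : Comp (fun _ B => dif B).
Proof. unfold dif. comp. Qed.
#[global] Hint Resolve comp_dif : comp_lib.

Lemma comp_spl : Comp (fun _ (p : list str * bool) => spl (fst p) (snd p)).
Proof. unfold spl. comp. Qed.
#[global] Hint Resolve comp_spl : comp_lib.

Lemma comp_blk : Comp (fun _ (p : str * list str) => blk (fst p) (snd p)).
Proof. unfold blk. comp. Qed.

Lemma comp_allstr : Comp (fun _ l => allstr l).
Proof. unfold allstr. comp. Qed.
#[global] Hint Resolve comp_blk comp_allstr : comp_lib.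

Lemma comp_ext_leaves : Comp (fun _ B => ext B).
Proof. unfold ext. comp. Qed.
#[global] Hint Resolve comp_ext_leaves : comp_lib.

Lemma comp_unify : Comp (fun _ (p : nat * list str) => unify (st (fst p)) (snd p)).
Proof. unfold unify, uni, best. comp. Qed.

Lemma comp_act : Comp (fun _ (p : nat * (nat * list str)) => act (st (fst p)) (fst (snd p)) (snd (snd p))).
Proof.
  unfold act. comp.
  refine (comp_subst _ (fun _ p => (fst (fst p), blk (snd p) (snd (snd (fst p))))) comp_unify _). comp.
Qed.

Lemma comp_acts : Comp (fun _ (p : list (nat * nat) * list str) => acts st (fst p) (snd p)).
Proof.
  unfold acts. comp.
  refine (comp_subst _ (fun _ p => (fst (snd (snd p)), (snd (snd (snd p)), fst (snd p)))) comp_act _). comp.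
Qed.
#[global] Hint Resolve comp_acts : comp_lib.

Lemma comp_stage : Comp (fun _ n => stage n).
Proof. unfold stage. comp. Qed.
#[global] Hint Resolve comp_stage : comp_lib.

Lemma comp_trace :
  Comp (fun _ (p : list str * (nat * nat)) => trace st (fst p) (snd p)).
Proof. unfold trace. comp. Qed.
#[global] Hint Resolve comp_trace : comp_lib.

(** * Histories along growing strings *)

Lemma zeros_S n : zeros (S n) = zeros n ++ [false].
Proof. unfold zeros, restr. now rewrite seq_S, map_app. Qed.

Lemma bound_at_S s q b : bound_at s q = Some b -> bound_at (S s) q = Some b.
Proof. unfold bound_at. rewrite zeros_S. apply Ev_app. Qed.

Lemma bound_at_le s t q b : s <= t -> bound_at s q = Some b -> bound_at t q = Some b.
Proof. induction 1; auto using bound_at_S. Qed.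

Lemma history_S g n b r N :
  history g n b r (S N) = history_step g n b r N (history g n b r N).
Proof. reflexivity. Qed.

Lemma history_grows g n b r N :
  exists v, snd (history g n b r (S N)) = v ++ snd (history g n b r N).
Proof.
  rewrite history_S; unfold history_step. destruct (history g n b r N) as [[] w]; cbn [fst snd]; [|now exists []].
  destruct (Ev r g (pair n N)) as [v|]; cbn [ocase snd]; [|now exists []].
  destruct w as [|x w]; cbn [lcase]; [now exists [v]|].
  destruct (_ || _); [now exists []|now exists [v]].
Qed.

(** An undefined computation freezes the history. On a longer string a history that was not frozen
    is unchanged, and a frozen one can only resume. *)
Lemma history_app g n b r t N :
  (fst (history g n b r N) = true -> history g n b (r ++ t) N = history g n b r N) /\
  exists v, snd (history g n b (r ++ t) N) = v ++ snd (history g n b r N).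
Proof.
  induction N as [|N [IH1 [v IH2]]]; [split; [easy|now exists []]|].
  destruct (fst (history g n b r N)) eqn:E.
  - specialize (IH1 eq_refl). destruct (Ev r g (pair n N)) as [x|] eqn:Ex.
    + assert (K : history g n b (r ++ t) (S N) = history g n b r (S N)).
      { rewrite !history_S, IH1; unfold history_step. rewrite E, Ex. now rewrite (Ev_app _ _ _ _ _ Ex). }
      rewrite K. split; [easy|now exists []].
    + split; [rewrite history_S; unfold history_step; rewrite E, Ex; discriminate|].
      destruct (history_grows g n b (r ++ t) N) as [u Hu]. exists u. rewrite Hu, IH1.
      rewrite (history_S g n b r N); unfold history_step; rewrite E, Ex. reflexivity.
  - assert (K : history g n b r (S N) = history g n b r N) by (rewrite history_S; unfold history_step; rewrite E; easy).
    rewrite K, E. split; [easy|]. destruct (history_grows g n b (r ++ t) N) as [u Hu].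
    exists (u ++ v). now rewrite Hu, IH2, app_assoc.
Qed.

(** Thanks to the cap this holds along every string, even where the functional breaks its promised
    bound; the potentials rely on that. *)
Lemma history_length g n b r N : length (snd (history g n b r N)) <= S b.
Proof.
  induction N as [|N IH]; [cbn; lia|]. rewrite history_S; unfold history_step.
  destruct (history g n b r N) as [[] w]; cbn [fst snd] in *; [|easy].
  destruct (Ev r g (pair n N)) as [v|]; cbn [ocase snd]; [|easy].
  destruct w as [|x w]; cbn [lcase]; [cbn; lia|].
  destruct (Nat.leb_spec (S b) (length (x :: w))); rewrite ?orb_true_r, ?orb_false_r; [easy|].
  destruct (v =? x); cbn in *; lia.
Qed.

Lemma st_ext q r b : exists v, st q (r ++ [b]) = v ++ st q r.
Proof.
  unfold st. rewrite length_app, Nat.add_1_r.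
  destruct (bound_at (length r) q) as [m|] eqn:E; cbn [ocase]; [|eexists; now rewrite app_nil_r].
  rewrite (bound_at_S _ _ _ E). cbn [ocase].
  destruct (history_grows (fst' (snd' q)) (fst' q) m (r ++ [b]) (length r)) as [u Hu].
  destruct (history_app (fst' (snd' q)) (fst' q) m r [b] (length r)) as [_ [v Hv]].
  exists (u ++ v). now rewrite Hu, Hv, app_assoc.
Qed.

Lemma st_length s q b r : bound_at s q = Some b -> length (st q r) <= S b.
Proof.
  intros E. unfold st. destruct (bound_at (length r) q) as [m|] eqn:Em; cbn [ocase]; [|cbn; lia].
  assert (m = b).
  { apply (bound_at_le _ (s + length r)) in E; [|lia].
    apply (bound_at_le _ (s + length r)) in Em; [|lia]. congruence. }
  subst m. apply history_length.
Qed.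

Lemma bound_at_complete n g b v : phi b n v ->
  exists N, forall s, N <= s -> bound_at s (pair n (pair g b)) = Some v.
Proof.
  intros H. unfold bound_at. rewrite fst'_pair, !snd'_pair. now apply Ev_complete.
Qed.

(** Where the functional keeps its promise the cap never suppresses a value, so the latest entry
    belongs to the last computed stage; once all stages up to [t0] are visible, it is the limit. *)
Lemma st_limit (Y : nat -> bool) g b n (G : nat -> nat) bn v t0 :
  (forall t, run Y (decode g) (pair n t) (G t)) -> phi b n bn ->
  (forall T, changes_upto (fun _ => G) n T <= bn) -> (forall t, t0 <= t -> G t = v) ->
  exists N, forall s, N <= s -> exists w, st (pair n (pair g b)) (restr Y s) = v :: w.
Proof.
  intros HG Hb Hc Hv. destruct (bound_at_complete n g b bn Hb) as [N0 H0].
  assert (H1 : exists N, forall s t, N <= s -> t <= t0 -> Ev (restr Y s) g (pair n t) = Some (G t)).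
  { clear Hv. induction t0 as [|t0 [N HN]].
    - destruct (Ev_complete _ _ _ _ (HG 0)) as [N HN]. exists N. intros s t L Lt.
      replace t with 0 by lia. now apply HN.
    - destruct (Ev_complete _ _ _ _ (HG (S t0))) as [N' HN']. exists (N + N'). intros s t L Lt.
      destruct (Nat.eq_dec t (S t0)) as [->|]; [apply HN'; lia|apply HN; lia]. }
  destruct H1 as [N1 H1]. exists (N0 + N1 + S t0). intros s L.
  unfold st. rewrite restr_length, H0 by lia. cbn [ocase]. rewrite fst'_pair, snd'_pair, fst'_pair.
  set (r := restr Y s).
  (* The first [T] stages have been computed, and those up to [t0] are among them. *)
  assert (I : forall M, exists T, T <= M /\ (fst (history g n bn r M) = true -> T = M) /\
     Nat.min (S t0) M <= T /\
     match T with
     | 0 => snd (history g n bn r M) = []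
     | S T' => exists w, snd (history g n bn r M) = G T' :: w /\
                 S (length w) <= S (changes_upto (fun _ => G) n T')
     end).
  { induction M as [|M (T & I1 & I2 & I3 & I4)]; [now exists 0|].
    rewrite history_S; unfold history_step. destruct (history g n bn r M) as [[] w] eqn:E; cbn [fst snd] in *.
    - rewrite (I2 eq_refl) in *. clear T I1 I2.
      destruct (Ev r g (pair n M)) as [x|] eqn:Ex; cbn [ocase snd].
      + apply (Ev_sound Y) in Ex; [|apply extends_restr].
        rewrite (run_det _ _ _ _ _ Ex (HG M)) in *. clear x Ex.
        exists (S M). split; [lia|]. split; [easy|]. split; [lia|].
        destruct M as [|M]; [subst w; cbn; eauto|].
        destruct I4 as (w' & -> & Lw). cbn [lcase changes_upto].
        specialize (Hc (S M)). cbn [changes_upto] in Hc. rewrite (Nat.eqb_sym (G M)) in *.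
        destruct (Nat.eqb_spec (G (S M)) (G M)) as [Eg|Ng]; cbn [orb].
        * rewrite Eg. exists w'. split; [easy|]. lia.
        (* A full history followed by yet another change would mean more than [bn] changes. *)
        * destruct (Nat.leb_spec (S bn) (length (G M :: w'))) as [Lb|Lb]; cbn [length] in *; [lia|].
          exists (G M :: w'). split; [easy|]. cbn [length]. lia.
      + exists M. split; [lia|]. split; [easy|]. split; [|easy].
        destruct (Nat.le_gt_cases M t0) as [LM|LM]; [|lia].
        unfold r in Ex. rewrite H1 in Ex by lia. discriminate.
    - exists T. split; [lia|]. split; [easy|]. split; [|easy].
      destruct (Nat.le_gt_cases (S t0) M) as [LM|LM]; [lia|exfalso].
      assert (A : forall M, M <= S t0 -> fst (history g n bn r M) = true).
      { clear - H1 L. induction M as [|M IH]; intros LM; [easy|]. rewrite history_S; unfold history_step; rewrite IH by lia.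
        unfold r. rewrite H1 by lia. reflexivity. }
      specialize (A M ltac:(lia)). rewrite E in A. discriminate. }
  destruct (I s) as (T & I1 & I2 & I3 & I4). destruct T as [|T]; [lia|].
  destruct I4 as (w & -> & _). exists w. f_equal. apply Hv. lia.
Qed.

(** * The list of claims *)

Lemma claimed_iff q cl : claimed q cl = true <-> In q (map fst cl).
Proof.
  unfold claimed. rewrite existsb_exists, in_map_iff. split.
  - intros [c [I E]]. apply Nat.eqb_eq in E. eauto.
  - intros [c [E I]]. exists c. split; [easy|]. now apply Nat.eqb_eq.
Qed.

Definition lower (m : nat) (cl : list (nat * nat)) : list (nat * nat) :=
  map (fun c => (fst c, Nat.min (snd c) m)) cl.

Lemma update_cases s cl :
  update s cl = cl \/
  (update s cl = lower (fst' (fst' s)) cl ++ [(fst' s, fst' (fst' s))] /\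
   ready (fst' s) s = true /\ ~ In (fst' s) (map fst cl)).
Proof.
  unfold update. destruct (ready (fst' s) s); cbn [andb]; [|now left].
  destruct (claimed (fst' s) cl) eqn:E; cbn [negb]; [now left|right].
  split; [easy|]. split; [easy|]. rewrite <- claimed_iff. congruence.
Qed.

Lemma claims_S s : claims (S s) = update s (claims s).
Proof. reflexivity. Qed.

Lemma leaves_S s : leaves (S s) = acts st (claims (S s)) (ext (leaves s)).
Proof. reflexivity. Qed.

Lemma in_lower m cl c : In c (lower m cl) -> exists d, In d cl /\ fst c = fst d /\ snd c = Nat.min (snd d) m.
Proof. intros I. apply in_map_iff in I as [d [<- I]]. now exists d. Qed.

Lemma map_fst_lower m cl : map fst (lower m cl) = map fst cl.
Proof. unfold lower. rewrite map_map. now apply map_ext. Qed.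

Lemma update_sorted s cl : StronglySorted le_level cl -> StronglySorted le_level (update s cl).
Proof.
  intros H. destruct (update_cases s cl) as [->|(-> & _ & _)]; [easy|].
  generalize (fst' (fst' s)) as m. intros m. induction H as [|c cl H IH F].
  - repeat constructor.
  - cbn. constructor; [exact IH|]. apply Forall_app. split.
    + apply Forall_forall. intros d I. apply in_lower in I as (d' & I & E1 & E2).
      rewrite Forall_forall in F. specialize (F d' I). unfold le_level in *. cbn. lia.
    + repeat constructor. unfold le_level. cbn. lia.
Qed.

Lemma claims_sorted s : StronglySorted le_level (claims s).
Proof. induction s; [constructor|]. now apply update_sorted. Qed.

Lemma claims_mono s t q : s <= t -> In q (map fst (claims s)) -> In q (map fst (claims t)).
Proof.
  induction 1 as [|t L IH]; [easy|]. intros I. specialize (IH I). rewrite claims_S.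
  destruct (update_cases t (claims t)) as [->|(-> & _ & _)]; [easy|].
  rewrite map_app, map_fst_lower. apply in_app_iff. now left.
Qed.

Lemma claims_level s c : In c (claims s) -> snd c <= fst' (fst c).
Proof.
  revert c. induction s as [|s IH]; [easy|]. intros c. rewrite claims_S.
  destruct (update_cases s (claims s)) as [->|(-> & _ & _)]; [apply IH|].
  rewrite in_app_iff. intros [I|[<-|[]]]; [|cbn; lia].
  apply in_lower in I as (d & I & E1 & E2). specialize (IH d I). rewrite E1. lia.
Qed.

Lemma claims_ready s q : In q (map fst (claims s)) -> ready q s = true.
Proof.
  assert (R : forall s, ready q s = true -> ready q (S s) = true).
  { intros t. unfold ready. rewrite !andb_true_iff. intros [H1 H2]. split; [easy|].
    destruct (bound_at t q) as [b|] eqn:E; [|discriminate]. now rewrite (bound_at_S _ _ _ E). }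
  induction s as [|s IH]; [easy|]. rewrite claims_S.
  destruct (update_cases s (claims s)) as [->|(-> & H & _)]; [auto|].
  rewrite map_app, map_fst_lower, in_app_iff. intros [I|[<-|[]]]; auto.
Qed.

Lemma Forall2_lowers_refl cl : Forall2 lowers cl cl.
Proof. induction cl; constructor; [|easy]. now split. Qed.

Lemma Forall2_lowers_lower m cl : Forall2 lowers cl (lower m cl).
Proof. induction cl; constructor; [|easy]. split; cbn; lia. Qed.

Lemma Forall2_firstn {X Y} (R : X -> Y -> Prop) k : forall l l', Forall2 R l l' ->
  Forall2 R (firstn k l) (firstn k l').
Proof. induction k; intros l l' F; [constructor|]. destruct F; constructor; auto. Qed.

Lemma claims_prefix_S s k : k <= length (claims s) ->
  Forall2 lowers (firstn k (claims s)) (firstn k (claims (S s))).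
Proof.
  intros L. rewrite claims_S. destruct (update_cases s (claims s)) as [->|(-> & _ & _)].
  - apply Forall2_lowers_refl.
  - rewrite firstn_app. unfold lower at 2. rewrite length_map.
    replace (k - length (claims s)) with 0 by lia. cbn [firstn]. rewrite app_nil_r.
    apply Forall2_firstn, Forall2_lowers_lower.
Qed.

Lemma claims_length_S s : length (claims s) <= length (claims (S s)).
Proof.
  rewrite claims_S. destruct (update_cases s (claims s)) as [->|(-> & _ & _)]; [easy|].
  unfold lower. rewrite length_app, length_map. lia.
Qed.

Lemma claims_length s t : s <= t -> length (claims s) <= length (claims t).
Proof. induction 1; [easy|]. pose proof (claims_length_S m). lia. Qed.

(** * The sets of leaves and the progress of old claims *)

Lemma leaves_len_nonempty s : len s (leaves s) /\ exists r, In r (leaves s).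
Proof.
  induction s as [|s [L H]].
  - split; [intros r [<-|[]]; easy|]. exists []. now left.
  - rewrite leaves_S. assert (K : keeps 0 (acts st (claims (S s)) (ext (leaves s))) (ext (leaves s))).
    { apply (acts_keeps st (S s)); [now apply ext_len|now apply ext_nonempty|lia]. }
    split; [exact (keeps_len _ _ _ _ (ext_len _ _ L) K)|exact (keeps_nonempty _ _ _ K)].
Qed.

Lemma leaves_len s : len s (leaves s).
Proof. apply leaves_len_nonempty. Qed.

Lemma leaves_nonempty s : exists r, In r (leaves s).
Proof. apply leaves_len_nonempty. Qed.

Lemma leaves_S_in s r : In r (leaves (S s)) -> exists t b, In t (leaves s) /\ r = t ++ [b].
Proof.
  rewrite leaves_S. intros I. apply in_ext. revert r I.
  apply (acts_keeps st (S s) 0); [apply ext_len, leaves_len|apply ext_nonempty, leaves_nonempty|lia].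
Qed.

(** Later claims have at least the level of an earlier one, so they only thin out its blocks, which
    stay uniform. *)
Lemma acts_uniform n cl : forall B, len n B -> (exists r, In r B) -> StronglySorted le_level cl ->
  forall c u, In c cl -> length u = snd c -> uniform (st (fst c)) (blk u (acts st cl B)).
Proof.
  induction cl as [|d cl IH]; intros B L H Hs c u; [easy|].
  apply StronglySorted_inv in Hs as [Hs F]. rewrite Forall_forall in F.
  pose proof (act_keeps n (st (fst d)) (snd d) B L H) as K.
  assert (L' := keeps_len _ _ _ _ L K). assert (H' := keeps_nonempty _ _ _ K).
  intros [<-|I] Lu; [|now apply IH].
  intros r r' I I'. cbn [acts fold_left] in I, I'.
  assert (K' : keeps (snd d) (acts st cl (act (st (fst d)) (snd d) B)) (act (st (fst d)) (snd d) B))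
    by (now apply (acts_keeps st n)).
  rewrite <- Lu in K', L', I, I'.
  apply (blk_keeps n u _ _ L' K') in I as [_ I], I' as [_ I'].
  apply (blk_act n) in I, I'; try easy. now apply (unify_uniform _ (blk u B)).
Qed.

Lemma leaves_uniform s c u : In c (claims s) -> length u = snd c ->
  uniform (st (fst c)) (blk u (leaves s)).
Proof.
  destruct s as [|s]; [easy|]. rewrite leaves_S.
  apply (acts_uniform (S s)); [apply ext_len, leaves_len|apply ext_nonempty, leaves_nonempty|apply claims_sorted].
Qed.

Lemma Forall2_lowers_fst l l' : Forall2 lowers l l' -> map fst l' = map fst l.
Proof. induction 1 as [|a b l l' [E _] F IH]; [easy|]. cbn. congruence. Qed.

Lemma claims_prefix_fst s t k : s <= t -> k <= length (claims s) ->
  map fst (firstn k (claims t)) = map fst (firstn k (claims s)).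
Proof.
  intros L Hk. induction L as [|t L IH]; [easy|]. rewrite <- IH.
  apply Forall2_lowers_fst, claims_prefix_S. pose proof (claims_length s t L). lia.
Qed.

Lemma claims_prefix_level s t k N : s <= t -> k <= length (claims s) ->
  (forall c, In c (firstn k (claims s)) -> snd c <= N) ->
  forall c, In c (firstn k (claims t)) -> snd c <= N.
Proof.
  intros L Hk H. induction L as [|t L IH]; [easy|].
  pose proof (claims_length s t L) as Lt.
  pose proof (claims_prefix_S t k ltac:(lia)) as F. clear H.
  induction F as [|a b l l' [_ E] F IHF]; [easy|].
  intros c [<-|I]; [specialize (IH a (or_introl eq_refl)); lia|].
  apply IHF; [|easy]. intros d Id. apply IH. now right.
Qed.

(* Number read off from the potentials of the first [k] claims; it decreases whenever one of them
   changes. *)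
Definition progress (D b k t : nat) : nat :=
  digits b (map (weight st D (leaves t)) (firstn k (claims t))).

(** A weight is at most [N + 2 ^ N * D], which gives the base [b]; the lexicographic descent of the
    first [k] claims then becomes descent of one number. *)
Lemma progress_S D N k s t : s <= t -> k <= length (claims s) ->
  (forall c, In c (firstn k (claims s)) -> snd c <= N) ->
  (forall c r, In c (firstn k (claims s)) -> length (st (fst c) r) <= D) ->
  let b := S (N + 2 ^ N * D) in
  progress D b k (S t) < progress D b k t \/
  (progress D b k (S t) = progress D b k t /\
   firstn k (claims (S t)) = firstn k (claims t) /\
   (forall c, In c (firstn k (claims t)) -> trace st (leaves (S t)) c = trace st (leaves t) c) /\
   seteq (acts st (firstn k (claims (S t))) (ext (leaves t))) (ext (leaves t))).
Proof.
  intros L Hk HN HD b. pose proof (claims_length s t L) as Lt.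
  assert (HDt : forall t c r, s <= t -> In c (firstn k (claims t)) -> length (st (fst c) r) <= D).
  { intros t' c r L' I. apply (in_map fst) in I. rewrite (claims_prefix_fst s t' k L' Hk) in I.
    apply in_map_iff in I as [d [<- I]]. now apply HD. }
  pose proof (acts_lex st D t (leaves t) (skipn k (claims (S t))) (leaves_len t) (leaves_nonempty t)
    st_ext (firstn k (claims t)) (firstn k (claims (S t))) (ext (leaves t))
    (claims_prefix_S t k ltac:(lia))) as X.
  cbv zeta in X. rewrite firstn_skipn, <- leaves_S in X.
  destruct X as [X|(X1 & X2 & X3 & X4)].
  - apply claims_sorted.
  - easy.
  - intros c u I. apply leaves_uniform. rewrite <- (firstn_skipn k). apply in_app_iff. now left.
  - intros c r. now apply HDt.
  - left. apply digits_lex; [exact X|]. intros x I. apply in_map_iff in I as [c [<- I]].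
    assert (Lc : snd c <= N) by (eapply (claims_prefix_level s (S t)); eauto).
    pose proof (pot_bound (st (fst c)) D (snd c) (leaves (S t))).
    pose proof (Nat.pow_le_mono_r 2 (snd c) N ltac:(lia) Lc).
    unfold weight, b. nia.
  - right. split; [unfold progress; now rewrite X2|]. split; [easy|]. split; [|easy].
    rewrite X1 in X3. intros c I. now apply (ext_in_map X3).
Qed.

(** * Descent, compactness and indices of finite sets *)

Lemma decreasing_stable (c : nat -> nat) (Q : nat -> Prop) s :
  (forall t, s <= t -> c (S t) < c t \/ (c (S t) = c t /\ Q t)) ->
  exists t0, s <= t0 /\ forall t, t0 <= t -> Q t.
Proof.
  remember (c s) as m eqn:E. revert s E. induction m as [m IH] using lt_wf_ind. intros s E H.
  destruct (classic (forall t, s <= t -> Q t)) as [Y|N]; [now exists s|].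
  apply not_all_ex_not in N as [t N]. apply imply_to_and in N as [L N].
  assert (M : forall t, s <= t -> c t <= c s).
  { intros t' L'. induction L' as [|t' L' IH']; [easy|]. destruct (H t' L') as [|[]]; lia. }
  destruct (IH (c (S t))) with (s := S t) as (t0 & L0 & Q0); [|easy| |].
  - destruct (H t L) as [|[_ Qt]]; [|easy]. pose proof (M t L). lia.
  - intros t' L'. apply H. lia.
  - exists t0. split; [lia|easy].
Qed.

Lemma changes_bounded g x (c : nat -> nat) T :
  (forall t, c (S t) < c t \/ (c (S t) = c t /\ g x (S t) = g x t)) ->
  changes_upto g x T + c T <= c 0.
Proof.
  intros H. induction T as [|T IH]; cbn [changes_upto]; [lia|].
  destruct (H T) as [|[E1 E2]].
  - destruct (g x T =? g x (S T)); lia.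
  - rewrite E2, Nat.eqb_refl. lia.
Qed.

Lemma restr_S X n : restr X (S n) = restr X n ++ [X n].
Proof. unfold restr. now rewrite seq_S, map_app. Qed.

(** Weak Koenig's lemma with an offset: it is also applied to a single block, which is closed under
    parents only from some stage on. *)
Lemma koenig (Q : nat -> list str) s0 :
  (forall s, s0 <= s -> len s (Q s)) -> (forall s, s0 <= s -> exists r, In r (Q s)) ->
  (forall s r, s0 <= s -> In r (Q (S s)) -> exists t b, In t (Q s) /\ r = t ++ [b]) ->
  exists X, forall s, s0 <= s -> In (restr X s) (Q s).
Proof.
  intros HL HN HS.
  assert (Down : forall s t r, s0 <= s -> s <= t -> In r (Q t) -> In (firstn s r) (Q s)).
  { intros s t r Ls L. revert r. induction L as [|t L IH]; intros r I.
    - rewrite firstn_all2; [easy|]. now rewrite (HL s Ls r I).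
    - apply HS in I as (r' & b & I & ->); [|lia]. specialize (IH r' I).
      assert (length r' = t) by (apply (HL t); [lia|easy]).
      rewrite firstn_app. replace (s - length r') with 0 by lia. cbn. now rewrite app_nil_r. }
  pose (good := fun p : str => forall s, s0 <= s -> length p <= s ->
    exists r, In r (Q s) /\ firstn (length p) r = p).
  (* If [p ++ [false]] dies at stage [s'], strings above [p] that live at the later of [s] and [s']
     must continue with [true]. *)
  assert (Next : forall p, exists b, good p -> good (p ++ [b])).
  { intros p. destruct (classic (good (p ++ [false]))) as [G|G]; [now exists false|].
    exists true. intros Gp s Ls Lp. rewrite length_app in *. cbn in Lp.
    apply not_all_ex_not in G as [s' G]. apply imply_to_and in G as [Ls' G].
    apply imply_to_and in G as [Lp' G]. rewrite length_app in *. cbn in Lp', G.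
    destruct (Gp (Nat.max s s') ltac:(lia) ltac:(lia)) as [r [I E]].
    assert (Lr : length r = Nat.max s s') by (apply (HL (Nat.max s s')); [lia|easy]).
    assert (P : firstn (length p + 1) r = p ++ [nth (length p) r false]).
    { rewrite <- (firstn_skipn (length p) r) at 1. rewrite E.
      destruct (skipn (length p) r) as [|x v] eqn:Ev.
      - exfalso. apply (f_equal (@length bool)) in Ev. rewrite length_skipn in Ev. cbn in Ev. lia.
      - rewrite firstn_app, firstn_all2 by lia. replace (length p + 1 - length p) with 1 by lia. cbn.
        replace (nth (length p) r false) with x; [easy|].
        rewrite <- (firstn_skipn (length p) r), Ev, E, app_nth2, Nat.sub_diag; [easy|lia]. }
    destruct (nth (length p) r false) eqn:Eb.
    - exists (firstn s r). split; [apply (Down s (Nat.max s s')); auto; lia|].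
      rewrite firstn_firstn. cbn. now rewrite Nat.min_l by lia.
    - exfalso. apply G. exists (firstn s' r). split; [apply (Down s' (Nat.max s s')); auto; lia|].
      rewrite firstn_firstn. now rewrite Nat.min_l by lia. }
  apply functional_choice in Next as [next Hnext].
  pose (path := fun n => natrec [] (fun _ p => p ++ [next p]) n).
  exists (fun n => next (path n)).
  assert (E : forall n, restr (fun n => next (path n)) n = path n).
  { induction n as [|n IH]; [easy|]. rewrite restr_S, IH. reflexivity. }
  assert (G : forall n, good (path n)).
  { induction n as [|n IH]; [|now apply Hnext].
    intros s Ls _. destruct (HN s Ls) as [r I]. now exists r. }
  intros s Ls. assert (Lp : length (path s) = s) by now rewrite <- E, restr_length.
  destruct (G s s Ls ltac:(lia)) as [r [I F]]. rewrite E, <- F, Lp, firstn_all2; [easy|].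
  now rewrite (HL s Ls r I).
Qed.

Lemma encode_const_code n :
  encode (const_code n) = natrec 0 (fun _ r => S (pair 5 (pair (encode CSucc) r))) n.
Proof. induction n as [|n IH]; [easy|]. cbn [const_code encode natrec]. now rewrite IH. Qed.

(** An s-m-n argument: the list is hardwired as a constant before a code that halts exactly on
    members, so the index is computable from the list. *)
Lemma finite_set_index : exists idx : list nat -> nat,
  Comp (fun _ V => idx V) /\ forall V x, W (idx V) x <-> In x V.
Proof.
  destruct (halting_code (X := list nat * nat) (fun _ p _ => existsb (fun v => v =? snd p) (fst p)))
    as [m Hm]; [comp|].
  exists (fun V => encode (CComp m (CPair (const_code (enc V)) (CPair CFst CSnd)))). split.
  - eapply comp_ext.
    + intros A V. cbn [encode]. rewrite encode_const_code. reflexivity.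
    + comp.
  - intros V x. unfold W, phi, Phi. rewrite decode_encode.
    assert (R : run no_oracle (CPair (const_code (enc V)) (CPair CFst CSnd)) x (enc (V, x)))
      by (apply run_pair; [apply run_const_code|apply run_id]).
    specialize (Hm no_oracle (V, x)). cbn [fst snd] in Hm.
    assert (E : (exists _ : nat, existsb (fun v => v =? x) V = true) <-> In x V).
    { split.
      - intros [_ H]. apply existsb_exists in H as [v [I Ev]]. apply Nat.eqb_eq in Ev. now subst.
      - intros I. exists 0. apply existsb_exists. exists x. split; [easy|apply Nat.eqb_refl]. }
    rewrite <- E, <- Hm. split.
    + intros [y Hy]. apply run_comp_inv in Hy as [u [H1 H2]].
      exists y. now rewrite (run_det _ _ _ _ _ R H1).
    + intros [y Hy]. exists y. eapply run_comp; [exact R|exact Hy].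
Qed.

(** * The class and the traceability of its members *)

Definition Pclass (A : nat -> bool) : Prop := forall s, In (restr A s) (leaves s).

(** A set outside the class betrays itself at a stage where its initial segment is not a leaf, and a
    search finds that stage. *)
Lemma Pclass_Pi01 : Pi01_class Pclass.
Proof.
  destruct (halting_code (X := nat) (fun A _ s => negb (existsb (ebeq (restr A s)) (leaves s))))
    as [c Hc].
  { comp. refine (comp_subst _ (fun _ p => snd (fst p)) comp_restr _). comp. }
  exists (encode c). intros A. unfold Phi. rewrite decode_encode. fold (run A c 0).
  specialize (Hc A 0). cbn [enc Enc_nat] in Hc. rewrite Hc. split.
  - intros H [s E]. rewrite negb_true_iff in E.
    enough (existsb (ebeq (restr A s)) (leaves s) = true) by congruence.
    apply existsb_exists. exists (restr A s). split; [apply H|apply ebeq_refl].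
  - intros H s. destruct (existsb (ebeq (restr A s)) (leaves s)) eqn:E.
    + apply existsb_exists in E as [r [I E]]. apply ebeq_eq in E. now rewrite E.
    + exfalso. apply H. exists s. now rewrite E.
Qed.

Lemma Pclass_nonempty : exists A, Pclass A.
Proof.
  destruct (koenig (fun s => leaves s) 0) as [X HX].
  - intros s _. apply leaves_len.
  - intros s _. apply leaves_nonempty.
  - intros s r _. apply leaves_S_in.
  - exists X. intros s. apply HX. lia.
Qed.

Lemma ready_eventually n g b v : pair g b <= n -> phi b n v ->
  exists N, forall s, N <= s -> ready (pair n (pair g b)) s = true.
Proof.
  intros L H. destruct (bound_at_complete n g b v H) as [N HN]. exists N. intros s Ls.
  unfold ready. rewrite (HN s Ls), fst'_pair, snd'_pair. cbn. rewrite andb_true_r.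
  now apply Nat.leb_le.
Qed.

Lemma claimed_eventually n g b v : pair g b <= n -> phi b n v ->
  exists s, claimed (pair n (pair g b)) (claims s) = true.
Proof.
  intros L H. destruct (ready_eventually n g b v L H) as [N HN].
  (* Stage [pair q N] attends to [q] and is not before [N], so [q] is ready there. *)
  set (q := pair n (pair g b)) in *. pose proof (pair_ge q N).
  destruct (claimed q (claims (pair q N))) eqn:E; [eauto|].
  exists (S (pair q N)). rewrite claims_S. unfold update. rewrite fst'_pair, HN, E by lia.
  cbn [andb negb]. apply claimed_iff. rewrite map_app, in_app_iff. right. now left.
Qed.

Lemma find_prefix {X} (f : X -> bool) l k x : In x (firstn k l) -> f x = true ->
  find f l = find f (firstn k l).
Proof.
  revert l. induction k as [|k IH]; intros [|a l] I E; try easy. cbn in *.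
  destruct (f a) eqn:Ea; [easy|]. destruct I as [->|I]; [congruence|]. now apply IH.
Qed.

Definition value_bound (s q : nat) : nat := ocase (bound_at s q) 0 (fun b => S b).

Lemma in_list_sum x l : In x l -> x <= list_sum l.
Proof.
  induction l as [|a l IH]; [easy|]. change (list_sum (a :: l)) with (a + list_sum l).
  intros [->|I]; [lia|]. specialize (IH I). lia.
Qed.

Lemma claims_st_length s c r : In c (claims s) -> length (st (fst c) r) <= value_bound s (fst c).
Proof.
  intros I. apply (in_map fst) in I. apply claims_ready in I. unfold ready in I.
  apply andb_true_iff in I as [_ I]. unfold value_bound.
  destruct (bound_at s (fst c)) as [b|] eqn:E; [|discriminate]. now apply (st_length s).
Qed.

(** Sums stand in for maxima as computable bounds on the levels and history lengths of all claims of
    stage [s]; [radix] is the base they give in [progress_S]. *)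
Definition level_sum (s : nat) : nat := list_sum (map snd (claims s)).
Definition value_bound_sum (s : nat) : nat :=
  list_sum (map (fun c => value_bound s (fst c)) (claims s)).
Definition radix (s : nat) : nat := S (level_sum s + 2 ^ level_sum s * value_bound_sum s).

Lemma comp_list_sum : Comp (fun _ l => list_sum l).
Proof.
  refine (comp_ext _ (fun _ l => listrec 0 (fun a _ r => a + r) l) _ _); [|comp].
  intros _ l. induction l as [|a l IH]; [easy|].
  change (list_sum (a :: l)) with (a + list_sum l). now rewrite IH.
Qed.
#[global] Hint Resolve comp_list_sum : comp_lib.

Lemma comp_radix : Comp (fun _ s => radix s).
Proof. unfold radix, level_sum, value_bound_sum, value_bound. comp. Qed.
#[global] Hint Resolve comp_radix : comp_lib.

Lemma progress_stage s t : s <= t ->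
  let k := length (claims s) in
  let D := value_bound_sum s in
  progress D (radix s) k (S t) < progress D (radix s) k t \/
  (progress D (radix s) k (S t) = progress D (radix s) k t /\
   firstn k (claims (S t)) = firstn k (claims t) /\
   (forall c, In c (firstn k (claims t)) -> trace st (leaves (S t)) c = trace st (leaves t) c) /\
   seteq (acts st (firstn k (claims (S t))) (ext (leaves t))) (ext (leaves t))).
Proof.
  intros L k D. apply (progress_S D (level_sum s) k s t); [easy|easy| |].
  - intros c I. unfold k in I. rewrite firstn_all in I. apply in_list_sum. now apply in_map.
  - intros c r I. unfold k in I. rewrite firstn_all in I.
    eapply Nat.le_trans; [now apply (claims_st_length s)|].
    apply in_list_sum. now apply (in_map (fun c => value_bound s (fst c))).
Qed.

(** A bound computable from the arrival stage; it is the change bound of the trace approximation. *)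
Lemma progress_bound s :
  progress (value_bound_sum s) (radix s) (length (claims s)) s <= radix s ^ length (claims s).
Proof.
  unfold progress. rewrite firstn_all. apply Nat.lt_le_incl.
  replace (length (claims s)) with (length (map (weight st (value_bound_sum s) (leaves s)) (claims s)))
    by apply length_map.
  apply digits_bound. intros x I. apply in_map_iff in I as [c [<- I]].
  pose proof (in_list_sum _ _ (in_map snd _ _ I)) as Lc. fold (level_sum s) in Lc.
  pose proof (pot_bound (st (fst c)) (value_bound_sum s) (snd c) (leaves s)).
  pose proof (Nat.pow_le_mono_r 2 (snd c) (level_sum s) ltac:(lia) Lc).
  unfold weight, radix. nia.
Qed.

Definition find_claim (q t : nat) : nat * nat :=
  ocase (find (fun c => fst c =? q) (claims t)) (0, 0) (fun c => c).

Definition trace_at (q t : nat) : list nat := trace st (leaves t) (find_claim q t).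

Lemma comp_trace_at : Comp (fun _ (p : nat * nat) => trace_at (fst p) (snd p)).
Proof. unfold trace_at, find_claim. comp. Qed.
#[global] Hint Resolve comp_trace_at : comp_lib.

Lemma find_claim_spec q t : In q (map fst (claims t)) ->
  In (find_claim q t) (claims t) /\ fst (find_claim q t) = q.
Proof.
  intros I. unfold find_claim. destruct (find _ _) as [c|] eqn:F; cbn [ocase].
  - apply find_some in F as [F E]. now apply Nat.eqb_eq in E.
  - exfalso. apply in_map_iff in I as [c [<- I]]. apply find_none with (x := c) in F; [|easy].
    rewrite Nat.eqb_refl in F. discriminate.
Qed.

Lemma trace_at_S s t q : s <= t -> In q (map fst (claims s)) ->
  let k := length (claims s) in
  let D := value_bound_sum s in
  progress D (radix s) k (S t) < progress D (radix s) k t \/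
  (progress D (radix s) k (S t) = progress D (radix s) k t /\ trace_at q (S t) = trace_at q t).
Proof.
  intros L I k D. destruct (progress_stage s t L) as [H|(H1 & H2 & H3 & _)]; [now left|right].
  split; [easy|]. fold k in H2, H3.
  assert (X : forall t, s <= t -> find_claim q t = ocase (find (fun c => fst c =? q) (firstn k (claims t)))
      (0, 0) (fun c => c) /\ In (find_claim q t) (firstn k (claims t))).
  { intros t' L'. assert (J : In q (map fst (firstn k (claims t')))).
    { rewrite (claims_prefix_fst s t') by easy. unfold k. now rewrite firstn_all. }
    apply in_map_iff in J as [c [E J]].
    unfold find_claim. rewrite (find_prefix _ _ k c J) by (now apply Nat.eqb_eq).
    split; [easy|]. destruct (find _ _) as [d|] eqn:F; cbn [ocase].
    - now apply find_some in F.
    - exfalso. apply find_none with (x := c) in F; [|easy]. apply Nat.eqb_neq in F. easy. }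
  unfold trace_at. destruct (X t L) as [E J]. destruct (X (S t) ltac:(lia)) as [E' _].
  assert (EE : find_claim q (S t) = find_claim q t) by (rewrite E, E', H2; reflexivity).
  rewrite EE. now apply H3.
Qed.

Lemma changes_upto_ext g g' x T : (forall t, g x t = g' x t) -> changes_upto g x T = changes_upto g' x T.
Proof. intros H. induction T as [|T IH]; [easy|]. cbn. now rewrite IH, !H. Qed.

Lemma Pclass_traceable A : Pclass A -> BLR_traceable A.
Proof.
  intros HA. exists (fun n => 2 ^ n). split.
  { split; [apply Comp_computable; comp|]. split.
    - intros m n L. apply Nat.pow_le_mono_r; lia.
    - intros k. exists k. apply Nat.lt_le_incl, Nat.pow_gt_lin_r. lia. }
  intros f (Gamma & bd & [g Hg] & [b Hb] & [Hlim Hch]).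
  destruct finite_set_index as (idx & Cidx & Widx).
  set (e := pair g b). set (q := fun n => pair n e).
  (* [t0 n] is the arrival stage of the claim for [n], and 0 for [n < e], where no claim ever
     arrives. Being least, it is computable although choice produces it. *)
  assert (Ht0 : exists t0, forall n,
    (n <? e) || claimed (q n) (claims (t0 n)) = true /\
    forall j, j < t0 n -> (n <? e) || claimed (q n) (claims j) = false).
  { apply (functional_choice (fun n t => (n <? e) || claimed (q n) (claims t) = true /\
      forall j, j < t -> (n <? e) || claimed (q n) (claims j) = false)).
    intros n. assert (H : exists s, (n <? e) || claimed (q n) (claims s) = true).
    { destruct (Nat.ltb_spec n e) as [L|L]; [now exists 0|].
      destruct (claimed_eventually n g b (bd n) L (Hb n)) as [s Hs]. now exists s. }
    destruct H as [s Hs]. induction s as [s IH] using lt_wf_ind.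
    destruct (classic (exists j, j < s /\ (n <? e) || claimed (q n) (claims j) = true)) as [[j [Lj Hj]]|N].
    - now apply (IH j).
    - exists s. split; [easy|]. intros j Lj.
      destruct ((n <? e) || claimed (q n) (claims j)) eqn:E; [|easy]. exfalso. eauto. }
  destruct Ht0 as [t0 Ht0].
  assert (Ct0 : Comp (fun _ n => t0 n)).
  { apply (comp_least (fun _ n s => (n <? e) || claimed (q n) (claims s)) (fun _ n => t0 n)).
    - unfold q, Nat.ltb. comp.
    - intros _ n. apply Ht0. }
  assert (HC : forall n, e <= n -> In (q n) (map fst (claims (t0 n)))).
  { intros n L. apply claimed_iff. destruct (Ht0 n) as [H _].
    destruct (Nat.ltb_spec n e); [lia|easy]. }
  (* The finitely many values below [e] are hardwired as singletons. *)
  set (tab := map (fun i => idx [f i]) (seq 0 e)).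
  (* [Nat.max] starts the approximation at the arrival stage, before which the potentials control
     nothing. *)
  set (G := fun n t => if S n <=? e then nth n tab 0 else idx (trace_at (q n) (Nat.max t (t0 n)))).
  set (B := fun n => if S n <=? e then 0 else radix (t0 n) ^ length (claims (t0 n))).
  assert (Gtab : forall n t, n < e -> G n t = idx [f n]).
  { intros n t L. unfold G. destruct (Nat.leb_spec (S n) e); [|lia].
    unfold tab. rewrite nth_indep with (d' := idx [f 0]) by (now rewrite length_map, length_seq).
    rewrite (map_nth (fun i => idx [f i]) (seq 0 e) 0). now rewrite seq_nth. }
  assert (Step : forall n, e <= n -> forall t,
    let p := fun t => progress (value_bound_sum (t0 n)) (radix (t0 n)) (length (claims (t0 n)))
       (Nat.max t (t0 n)) in
    p (S t) < p t \/ (p (S t) = p t /\ trace_at (q n) (Nat.max (S t) (t0 n)) = trace_at (q n) (Nat.max t (t0 n)))).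
  { intros n Ln t p. unfold p. destruct (Nat.le_gt_cases (t0 n) t) as [L|L].
    - rewrite !Nat.max_l by lia. now apply trace_at_S, HC.
    - rewrite !Nat.max_r by lia. now right. }
  assert (Lim : forall n, exists r, (exists s, forall t, s <= t -> G n t = r) /\
    (e <= n -> exists V, r = idx V /\ exists s, forall t, s <= t -> trace_at (q n) t = V)).
  { intros n. destruct (Nat.le_gt_cases e n) as [Ln|Ln].
    - destruct (decreasing_stable _ _ 0 (fun t _ => Step n Ln t)) as (s & _ & Hs).
      set (V := trace_at (q n) (Nat.max s (t0 n))).
      assert (K : forall t, s <= t -> trace_at (q n) (Nat.max t (t0 n)) = V).
      { intros t L. induction L as [|t L IH]; [easy|]. now rewrite Hs. }
      exists (idx V). split.
      + exists s. intros t L. unfold G. destruct (Nat.leb_spec (S n) e); [lia|]. now rewrite K.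
      + intros _. exists V. split; [easy|]. exists (Nat.max s (t0 n)). intros t L.
        rewrite <- (K t) by lia. now rewrite Nat.max_l by lia.
    - exists (idx [f n]). split; [|lia]. exists 0. intros. now apply Gtab. }
  apply functional_choice in Lim as [r Hr].
  assert (Wr : forall n, e <= n -> exists V, (forall x, W (r n) x <-> In x V) /\
     exists s, forall t, s <= t -> trace_at (q n) t = V).
  { intros n L. destruct (Hr n) as [_ H]. destruct (H L) as (V & -> & Hs). exists V. auto. }
  assert (Wtab : forall n, n < e -> forall x, W (r n) x <-> x = f n).
  { intros n L x. destruct (Hr n) as [[s H] _]. rewrite <- (H s (le_n s)), Gtab by easy.
    rewrite Widx. cbn. intuition. }
  exists r. split; [|split].
  - exists G, B. split; [|split; [|split]].
    + apply Comp_computable2. unfold G, q. comp.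
    + apply Comp_computable. unfold B. comp.
    + intros n. apply Hr.
    + intros n T. destruct (Nat.le_gt_cases e n) as [Ln|Ln].
      * pose proof (changes_bounded G n (fun t => progress (value_bound_sum (t0 n)) (radix (t0 n))
          (length (claims (t0 n))) (Nat.max t (t0 n))) T) as H.
        cbv beta in H. rewrite Nat.max_0_l in H. pose proof (progress_bound (t0 n)).
        unfold B. destruct (Nat.leb_spec (S n) e); [lia|].
        enough (changes_upto G n T + progress (value_bound_sum (t0 n)) (radix (t0 n))
          (length (claims (t0 n))) (Nat.max T (t0 n)) <= progress (value_bound_sum (t0 n)) (radix (t0 n))
          (length (claims (t0 n))) (t0 n)) by lia.
        apply H. intros t. destruct (Step n Ln t) as [|[E1 E2]]; [now left|right].
        split; [easy|]. unfold G. destruct (Nat.leb_spec (S n) e); [lia|]. now rewrite E2.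
      * replace (changes_upto G n T) with 0; [lia|]. symmetry.
        induction T as [|T IH]; [easy|]. cbn [changes_upto]. rewrite IH, !Gtab by easy.
        now rewrite Nat.eqb_refl.
  - intros n l Nd Hl. destruct (Nat.le_gt_cases e n) as [Ln|Ln].
    + destruct (Wr n Ln) as (V & HV & s & Hs).
      pose proof (claims_mono (t0 n) (s + t0 n) (q n) ltac:(lia) (HC n Ln)) as Iq.
      destruct (find_claim_spec _ _ Iq) as [Ic Ec].
      eapply Nat.le_trans; [apply (NoDup_incl_length Nd (l' := V)); intros x I; now apply HV, Hl|].
      rewrite <- (Hs (s + t0 n)) by lia. unfold trace_at.
      eapply Nat.le_trans; [apply trace_card|]. apply Nat.pow_le_mono_r; [lia|].
      (* Lowering keeps the level at or below [n], so at most [2 ^ n] values remain. *)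
      apply claims_level in Ic. rewrite Ec in Ic. unfold q in Ic. now rewrite fst'_pair in Ic.
    + assert (L1 : length l <= length [f n]).
      { apply (NoDup_incl_length Nd). intros x I. apply Hl, (Wtab n Ln) in I. now left. }
      cbn in L1. pose proof (Nat.pow_nonzero 2 n ltac:(lia)). lia.
  - intros n. destruct (Nat.le_gt_cases e n) as [Ln|Ln]; [|now apply Wtab].
    destruct (Wr n Ln) as (V & HV & s & Hs). apply HV.
    destruct (Hlim n) as [t1 Ht1].
    destruct (st_limit A g b n (Gamma n) (bd n) (f n) t1) as [N HN].
    + intros t. pose proof (Hg (pair n t)) as H. now rewrite fst'_pair, snd'_pair in H.
    + apply Hb.
    + intros T. eapply Nat.le_trans; [|apply (Hch n T)]. apply Nat.eq_le_incl.
      now apply changes_upto_ext.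
    + exact Ht1.
    + set (t := s + t0 n + N). destruct (HN t ltac:(lia)) as [w Hw]. fold e in Hw.
      pose proof (claims_mono (t0 n) t (q n) ltac:(lia) (HC n Ln)) as Iq.
      destruct (find_claim_spec _ _ Iq) as [Ic Ec].
      rewrite <- (Hs t) by lia. unfold trace_at.
      eapply in_trace; [apply (leaves_len t)| |apply (HA t)|rewrite Ec; exact Hw].
      intros u. now apply leaves_uniform.
Qed.

(** * Noncomputability of the members *)

(** Computability refers to [no_oracle], while [Comp] wants one code for all oracles; answering
    every query by zero reconciles the two. *)
Fixpoint strip (c : code) : code :=
  match c with
  | COracle => CZero
  | CPair f g => CPair (strip f) (strip g)
  | CComp f g => CComp (strip f) (strip g)
  | CRec f g => CRec (strip f) (strip g)
  | CMin f => CMin (strip f)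
  | c => c
  end.

Lemma eval_strip s X : forall c x, eval s X (strip c) x = eval s no_oracle c x.
Proof.
  induction s as [|s IH]; intros c x; [easy|]. destruct c; cbn [strip eval]; try reflexivity.
  - now rewrite !IH.
  - rewrite IH. now destruct (eval s no_oracle c2 x); cbn [obind].
  - induction (snd' x) as [|n IHn]; [apply IH|]. rewrite IHn.
    match goal with |- obind ?o _ = _ => destruct o; cbn [obind]; [apply IH|easy] end.
  - change (eval_min (eval s X) (strip c) x s 0 = eval_min (eval s no_oracle) c x s 0).
    generalize s at 2 4 as k. generalize 0 as i. intros i k. revert i.
    induction k as [|k IHk]; intros i; [easy|]. cbn [eval_min]. rewrite IH.
    destruct (eval s no_oracle c (pair x i)) as [v|]; cbn [obind]; [|easy].
    destruct (v =? 0); [easy|apply IHk].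
Qed.

Lemma computable_set_Comp A : computable_set A -> Comp (fun _ n => A n).
Proof.
  intros [a Ha]. exists (strip (decode a)). intros X x. destruct (Ha x) as [s Hs].
  exists s. rewrite eval_strip. exact Hs.
Qed.

Lemma changes_of_switch (g : nat -> nat -> nat) x T :
  (forall t, g x t <= 1) -> (forall t, g x t <= g x (S t)) -> changes_upto g x T <= g x T.
Proof.
  intros H1 H2. induction T as [|T IH]; cbn; [lia|].
  destruct (Nat.eqb_spec (g x T) (g x (S T))); [lia|].
  pose proof (H1 (S T)). pose proof (H2 T). lia.
Qed.

(** * Persistence of branching *)

Lemma claimed_stable Q : exists s, forall q t, q < Q -> In q (map fst (claims t)) ->
  In q (map fst (claims s)).
Proof.
  induction Q as [|Q [s IH]]; [exists 0; lia|].
  destruct (classic (exists t, In Q (map fst (claims t)))) as [[u Hu]|N].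
  - exists (s + u). intros q t L I. destruct (Nat.eq_dec q Q) as [->|].
    + apply (claims_mono u); [lia|easy].
    + apply (claims_mono s); [lia|]. apply (IH q t); [lia|easy].
  - exists s. intros q t L I. destruct (Nat.eq_dec q Q) as [->|]; [exfalso; eauto|].
    apply (IH q t); [lia|easy].
Qed.

Lemma pair_bounded n : exists Q, forall i j, i <= n -> j <= n -> pair i j < Q.
Proof.
  exists (S (list_max (map (fun p => pair (fst p) (snd p)) (list_prod (seq 0 (S n)) (seq 0 (S n)))))).
  intros i j Li Lj. apply Nat.lt_succ_r.
  pose proof (proj1 (list_max_le (map (fun p => pair (fst p) (snd p))
    (list_prod (seq 0 (S n)) (seq 0 (S n)))) _) (le_n _)) as H.
  rewrite Forall_forall in H. apply H. apply in_map_iff. exists (i, j). split; [easy|].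
  apply in_prod; apply in_seq; lia.
Qed.

(** A claim of a requirement with level at most [n] has both components at most [n], so all of these
    have arrived by some stage. Later claims start above [n] and are lowered only by arrivals that
    also lie above [n]. *)
Lemma late_claims_level n : exists s, forall t, s <= t ->
  forall c, In c (skipn (length (claims s)) (claims t)) -> n < snd c.
Proof.
  destruct (pair_bounded n) as [Q HQ]. destruct (claimed_stable Q) as [s Hs].
  exists s. intros t L. induction L as [|t L IH].
  - rewrite skipn_all. easy.
  - pose proof (claims_length s t L) as Lt. rewrite claims_S.
    destruct (update_cases t (claims t)) as [->|(-> & R & N)]; [easy|].
    assert (Lq : n < fst' (fst' t)).
    { apply Nat.nle_gt. intros Le. apply N. apply (claims_mono s); [easy|].
      apply (Hs (fst' t) (S t)).
      - unfold ready in R. apply andb_true_iff in R as [R _]. apply Nat.leb_le in R.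
        rewrite <- (pair_fst_snd (fst' t)). apply HQ; lia.
      - rewrite claims_S. destruct (update_cases t (claims t)) as [E|(-> & _ & _)].
        + exfalso. apply N. revert E. unfold update.
          rewrite R. destruct (claimed (fst' t) (claims t)) eqn:C; [now rewrite claimed_iff in C|].
          cbn [andb negb]. intros E. apply (f_equal (@length _)) in E.
          rewrite length_app, length_map in E. cbn in E. lia.
        + rewrite map_app, in_app_iff. right. now left. }
    intros c. unfold lower. rewrite skipn_app, length_map.
    replace (length (claims s) - length (claims t)) with 0 by lia. cbn [skipn].
    rewrite skipn_map, in_app_iff. intros [I|[<-|[]]]; [|easy].
    apply in_map_iff in I as [d [<- I]]. specialize (IH d I). cbn. lia.
Qed.

(** Old claims eventually change nothing, by descent of their potentials, and late ones act above
    level [n]. *)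
Lemma leaves_keeps_eventually n : exists t0, forall t, t0 <= t ->
  keeps (S n) (leaves (S t)) (ext (leaves t)).
Proof.
  destruct (late_claims_level n) as [s Hs].
  destruct (decreasing_stable _ _ s (progress_stage s)) as (t0 & L0 & H0).
  exists t0. intros t L. destruct (H0 t L) as (_ & _ & H). clear H0.
  rewrite leaves_S. rewrite <- (firstn_skipn (length (claims s)) (claims (S t))) at 1.
  unfold acts. rewrite fold_left_app. fold (acts st (firstn (length (claims s)) (claims (S t))) (ext (leaves t))).
  assert (LE := ext_len t (leaves t) (leaves_len t)).
  assert (NE := ext_nonempty _ (leaves_nonempty t)).
  set (E := acts st (firstn (length (claims s)) (claims (S t))) (ext (leaves t))) in *.
  assert (K : keeps (S n) E (ext (leaves t))) by (now apply (keeps_seteq (S t))).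
  apply (keeps_trans (S t)) with (B1 := E); [easy| |easy].
  apply (acts_keeps st (S t)); [eapply keeps_len; eauto|eapply keeps_nonempty; eauto|].
  intros c I. apply (Hs (S t)); [lia|easy].
Qed.

(** Each stage adds one level of branching, which the pruning then respects, until depth [S n] is
    reached. *)
Lemma leaves_full_eventually n : exists t0, forall t, t0 <= t ->
  keeps (S n) (leaves (S t)) (ext (leaves t)) /\ full (S n) (leaves t).
Proof.
  destruct (leaves_keeps_eventually n) as [t0 H0].
  assert (F : forall i t, t0 + i <= t -> i <= S n -> full i (leaves t)).
  { induction i as [|i IH]; intros t L Li; [intros u Lu; lia|].
    destruct t as [|t]; [lia|].
    apply (full_keeps (S t) (S i) _ (ext (leaves t))); [apply ext_len, leaves_len| |].
    - eapply keeps_le; [exact Li|apply H0; lia].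
    - apply (full_ext t); [apply leaves_len|apply leaves_nonempty|apply IH; lia]. }
  exists (t0 + S n). intros t L. split; [apply H0; lia|now apply F].
Qed.

Lemma Pclass_noncomputable A : Pclass A -> ~ computable_set A.
Proof.
  intros HA CA. apply computable_set_Comp in CA.
  set (G := fun (X : nat -> bool) (t : nat) =>
    if existsb (fun x => negb (Bool.eqb (X x) (A x))) (seq 0 t) then 1 else 0).
  assert (CG : Comp (fun X p => G X (snd' p))).
  { unfold G. comp. }
  destruct CG as [cg Hg].
  assert (CB : Comp (fun _ (_ : nat) => 1)) by comp. destruct CB as [cb Hb].
  (* The functional is traced at its own index pair, the least argument that [ready] admits; its
     bound is constantly 1 since the value switches at most once. *)
  set (g := encode cg). set (b := encode cb). set (n := pair g b). set (q := pair n n).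
  assert (HG : forall X t, run X (decode g) (pair n t) (G X t)).
  { intros X t. unfold g. rewrite decode_encode. pose proof (Hg X (pair n t)) as H.
    cbn [enc Enc_nat] in H. now rewrite snd'_pair in H. }
  assert (HB : phi b n 1).
  { unfold phi, Phi, b. rewrite decode_encode. apply (Hb no_oracle n). }
  assert (G1 : forall X t, G X t <= 1) by (intros; unfold G; destruct (existsb _ _); lia).
  assert (Gmono : forall X t, G X t <= G X (S t)).
  { intros X t. unfold G. rewrite seq_S, existsb_app. destruct (existsb _ (seq 0 t)); cbn [orb]; [easy|apply Nat.le_0_l]. }
  assert (GC : forall X T, changes_upto (fun _ => G X) n T <= 1).
  { intros X T. eapply Nat.le_trans; [apply changes_of_switch|apply G1]; auto. }
  destruct (claimed_eventually n g b 1 (le_n n) HB) as [s0 Hs0].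
  apply claimed_iff in Hs0. fold n q in Hs0.
  destruct (leaves_full_eventually n) as [t1 H1].
  set (t2 := s0 + t1).
  destruct (blk_cover (S n) (leaves t2) (restr A t2) (HA t2)) as [u [Lu Iu]].
  assert (Back : forall t v r, t2 <= t -> length v = S n -> In r (blk v (leaves (S t))) ->
    exists r' c, In r' (blk v (leaves t)) /\ r = r' ++ [c]).
  { intros t v r L Lv I. destruct (H1 t ltac:(lia)) as [K _]. rewrite <- Lv in K.
    apply (blk_keeps (S t) v _ _ (ext_len _ _ (leaves_len t)) K) in I as [_ I].
    now apply (blk_ext t) in I; [|apply leaves_len]. }
  (* With persistent branching the parents of a block lie in the block of the same address, so [A]
     never leaves its block. *)
  assert (IA : forall t, t2 <= t -> In (restr A t) (blk u (leaves t))).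
  { intros t L. induction L as [|t L IH]; [easy|].
    destruct (blk_cover (S n) (leaves (S t)) (restr A (S t)) (HA (S t))) as [v [Lv Iv]].
    destruct (Back t v _ L Lv Iv) as (r' & c & I & E). rewrite restr_S in E.
    apply app_inj_tail in E as [<- _].
    assert (u = v).
    { apply (full_blk_inj (leaves t) u v (restr A t)); [rewrite Lu; apply H1; lia|congruence|easy|easy]. }
    now subst v. }
  destruct (exists_last (l := u)) as [u0 [c Eu]]; [now destruct u|].
  assert (Lu0 : length u0 = n) by (rewrite Eu, length_app in Lu; cbn in Lu; lia).
  (* The sibling of the block of [A]: disjoint from it, but inside the same block of level [n],
     where the claim forces equal histories. *)
  set (v := u0 ++ [negb c]).
  assert (Lv : length v = S n) by (unfold v; rewrite length_app; cbn; lia).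
  destruct (koenig (fun t => blk v (leaves t)) t2) as [X HX].
  - intros t _. apply blk_len, leaves_len.
  - intros t _. apply (blk_nonempty t); [apply leaves_len|apply leaves_nonempty].
  - intros t r L I. now apply Back.
  - assert (Diff : exists x, X x <> A x).
    { apply NNPP. intros N. assert (E : restr X t2 = restr A t2).
      { unfold restr. apply map_ext. intros x. apply NNPP. intros D. apply N. now exists x. }
      assert (uv : u = v).
      { apply (full_blk_inj (leaves t2) u v (restr A t2)); [rewrite Lu; apply H1; lia|congruence|easy|].
        rewrite <- E. now apply HX. }
      rewrite Eu in uv. unfold v in uv. apply app_inj_tail in uv as [_ uv]. now destruct c. }
    destruct Diff as [x Dx].
    destruct (st_limit A g b n (G A) 1 0 0 (HG A) HB (GC A)) as [N0 K0].
    { intros t _. unfold G. destruct (existsb _ _) eqn:E; [|easy].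
      apply existsb_exists in E as [y [_ E]]. now rewrite eqb_reflx in E. }
    destruct (st_limit X g b n (G X) 1 1 (S x) (HG X) HB (GC X)) as [N1 K1].
    { intros t L. unfold G. destruct (existsb _ _) eqn:E; [easy|]. exfalso.
      enough (existsb (fun x => negb (Bool.eqb (X x) (A x))) (seq 0 t) = true) by congruence.
      apply existsb_exists. exists x. split; [apply in_seq; lia|].
      apply negb_true_iff, eqb_false_iff. exact Dx. }
    set (t := t2 + N0 + N1).
    destruct (K0 t ltac:(lia)) as [w0 E0]. destruct (K1 t ltac:(lia)) as [w1 E1].
    pose proof (claims_mono s0 t q ltac:(lia) Hs0) as Iq.
    destruct (find_claim_spec q t Iq) as [Ic Ec].
    pose proof (claims_level _ _ Ic) as Lc. rewrite Ec in Lc.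
    replace (fst' q) with n in Lc by (symmetry; apply fst'_pair).
    set (l := snd (find_claim q t)) in *.
    (* The claim may have been lowered to some [l <= n]; the common block is then addressed by the
       first [l] bits of [u0]. *)
    assert (J : forall r d, In r (blk (u0 ++ d) (leaves t)) -> In r (blk (firstn l u0) (leaves t))).
    { intros r d I. rewrite <- (firstn_skipn l u0), <- app_assoc, blk_app in I. now apply blk_incl in I. }
    assert (EQ : st q (restr A t) = st q (restr X t)).
    { pose proof (leaves_uniform t _ (firstn l u0) Ic) as U. rewrite Ec in U. apply U.
      - rewrite length_firstn. fold l. lia.
      - apply (J _ [c]). rewrite <- Eu. apply IA. lia.
      - apply (J _ [negb c]). apply HX. lia. }
    fold n in E0, E1. fold q in E0, E1. rewrite E0, E1 in EQ. discriminate.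
Qed.

Theorem mainTheorem5 :
  exists P : (nat -> bool) -> Prop,
    Pi01_class P /\
    (exists A, P A) /\
    (forall A, P A -> ~ computable_set A) /\
    (forall A, P A -> BLR_traceable A).
Proof.
  exists Pclass. split; [exact Pclass_Pi01|]. split; [exact Pclass_nonempty|].
  split; [exact Pclass_noncomputable|exact Pclass_traceable].
Qed.
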